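(* Let $T$ be a positive theory and let $k\ge 2$ be a natural number. Then the following implications between properties of $T$ hold: (1) if $T$ has $\mathsf{SOP_3}$ then $T$ has $\mathsf{SOP_2}$; (2) $T$ has $\mathsf{SOP_2}$ if and only if $T$ has $\mathsf{TP_1}$; (3) if $T$ has $\mathsf{SOP_2}$ then $T$ has $\mathsf{SOP_1}$; (4) if $T$ has $\mathsf{SOP_1}$ then $T$ has $2$-$\mathsf{TP}$; (5) $T$ has $2$-$\mathsf{TP}$ if and only if $T$ has $k$-$\mathsf{TP}$; (6) if $T$ has $2$-$\mathsf{TP}$ then $T$ has $\mathsf{OP}$; (7) if $T$ has $2$-$\mathsf{TP_2}$ then $T$ has $k$-$\mathsf{TP_2}$; (8) if $T$ has $k$-$\mathsf{TP_2}$ then $T$ has $k$-$\mathsf{TP}$; (9) if $T$ has $2$-$\mathsf{TP_2}$ then $T$ has $\mathsf{IP}$; (10) if $T$ has $\mathsf{IP}$ then $T$ has $\mathsf{OP}$.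
   Context: Positive logic conventions. Fix a first-order signature $\mathcal L$. A formula always means a positive formula: one built from atomic formulas using $\wedge,\vee,\top,\bot,\exists$. A (positive) theory $T$ is a set of h-inductive sentences, i.e. sentences $\forall x(\phi(x)\to\psi(x))$ with $\phi,\psi$ positive formulas. Variables $x,y,\dots$ in formulas are finite tuples. A negation of a formula $\phi(x)$ is a (positive) formula $\psi(x)$ with $T\models\neg\exists x(\phi(x)\wedge\psi(x))$. A model $M$ of $T$ is existentially closed (e.c.) if whenever $M\not\models\phi(a)$ there is a negation $\psi$ of $\phi$ with $M\models\psi(a)$. Standing assumption: $T$ has the joint continuation property (any two models of $T$ admit homomorphisms into a common model of $T$), and one works in a monster model $\mathfrak M$: an e.c. model that is very homogeneous (small tuples have the same positive type over a small set iff conjugate by an automorphism fixing that set) and very saturated (small finitely satisfiable sets of positive formulas over $\mathfrak M$ are satisfiable in $\mathfrak M$). All parameters are in $\mathfrak M$; $\models\phi(a)$ means $\mathfrak M\models\phi(a)$; consistent means satisfiable in $\mathfrak M$. Tree notation: $\eta\preceq\mu$ means $\mu$ extends $\eta$; $\eta,\mu$ are incomparable if neither extends the other; $\eta^\frown\mu$ is concatenation; $\sigma|_n$ is restriction. A formula $\phi(x,y)$ has: - $\mathsf{OP}$ if there are $(a_i)_{i<\omega}$, $(b_i)_{i<\omega}$ and a negation $\psi(x,y)$ of $\phi(x,y)$ such that for all $i,j<\omega$: $\models\phi(a_i,b_j)$ if $i<j$ and $\models\psi(a_i,b_j)$ if $i\ge j$. - $\mathsf{IP}$ if there are $(a_i)_{i<\omega}$,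 $(c_\sigma)_{\sigma\in2^\omega}$ and a negation $\psi(x,y)$ of $\phi(x,y)$ such that for all $i,\sigma$: $\models\phi(a_i,c_\sigma)$ if $\sigma(i)=1$ and $\models\psi(a_i,c_\sigma)$ if $\sigma(i)=0$. - $k$-$\mathsf{TP}$ ($k\ge2$) if there are $(a_\eta)_{\eta\in\omega^{<\omega}}$ and a negation $\psi(y_1,\dots,y_k)$ of $\exists x(\phi(x,y_1)\wedge\dots\wedge\phi(x,y_k))$ such that for all $\sigma\in\omega^\omega$ the set $\{\phi(x,a_{\sigma|_n}):n<\omega\}$ is consistent, and for all $\eta\in\omega^{<\omega}$ and $i_1<\dots<i_k<\omega$, $\models\psi(a_{\eta^\frown i_1},\dots,a_{\eta^\frown i_k})$. - $\mathsf{TP_1}$ if there are $(a_\eta)_{\eta\in\omega^{<\omega}}$ and a negation $\psi(y_1,y_2)$ of $\exists x(\phi(x,y_1)\wedge\phi(x,y_2))$ such that for all $\sigma\in\omega^\omega$ the set $\{\phi(x,a_{\sigma|_n}):n<\omega\}$ is consistent, and for all incomparable $\mu,\eta\in\omega^{<\omega}$, $\models\psi(a_\mu,a_\eta)$. - $k$-$\mathsf{TP_2}$ ($k\ge2$) if there are $(a_{i,j})_{i,j<\omega}$ and a negation $\psi(y_1,\dots,y_k)$ of $\exists x(\phi(x,y_1)\wedge\dots\wedge\phi(x,y_k))$ such that for all $\sigma\in\omega^\omega$ the set $\{\phi(x,a_{i,\sigma(i)}):i<\omega\}$ is consistent, and for all $i<\omega$ and $j_1<\dots<j_k<\omega$,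 $\models\psi(a_{i,j_1},\dots,a_{i,j_k})$. - $\mathsf{SOP_1}$ if there are $(a_\eta)_{\eta\in2^{<\omega}}$ and a negation $\psi(y_1,y_2)$ of $\exists x(\phi(x,y_1)\wedge\phi(x,y_2))$ such that for all $\sigma\in2^\omega$ the set $\{\phi(x,a_{\sigma|_n}):n<\omega\}$ is consistent, and for all $\mu,\eta\in2^{<\omega}$, if $\mu^\frown0\preceq\eta$ then $\models\psi(a_{\mu^\frown1},a_\eta)$. - $\mathsf{SOP_2}$ if there are $(a_\eta)_{\eta\in2^{<\omega}}$ and a negation $\psi(y_1,y_2)$ of $\exists x(\phi(x,y_1)\wedge\phi(x,y_2))$ such that for all $\sigma\in2^\omega$ the set $\{\phi(x,a_{\sigma|_n}):n<\omega\}$ is consistent, and for all incomparable $\mu,\eta\in2^{<\omega}$, $\models\psi(a_\mu,a_\eta)$. A theory $T$ has one of these properties if some formula has it. A theory $T$ has $\mathsf{SOP_3}$ if there are formulas $\phi_0(x,y)$, $\phi_1(x,y)$, a sequence $(a_i)_{i<\omega}$ and a negation $\psi(y_1,y_2)$ of $\exists x(\phi_0(x,y_2)\wedge\phi_1(x,y_1))$ such that for all $k<\omega$ the set $\{\phi_0(x,a_i):i<k\}\cup\{\phi_1(x,a_j):j\ge k\}$ is consistent, and for all $i<j<\omega$, $\models\psi(a_i,a_j)$. *)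

(* Defs.v *)
From mathcomp Require Import all_boot.
From mathcomp Require Import boolp classical_sets functions cardinality.

Set Implicit Arguments.
Unset Strict Implicit.
Unset Printing Implicit Defensive.

Local Open Scope classical_set_scope.

Definition copair (A B C : Type) (f : A -> C) (g : B -> C) (s : A + B) : C :=
  match s with inl x => f x | inr y => g y end.

Record signature := Signature {
  fun_sym : Type;
  fun_ar : fun_sym -> nat;
  rel_sym : Type;
  rel_ar : rel_sym -> nat }.

Inductive term (L : signature) (V : Type) : Type :=
| Var of V
| App (f : fun_sym L) of ('I_(fun_ar f) -> term L V).
Arguments Var {L V}.
Arguments App {L V}.

(* Positive formulas with free variables in an arbitrary type V. FEx binds a
   finite tuple: in [FEx n phi] the variables [inl i] of phi are bound. A
   formula over a structure M has variables in V + M, the elements of M being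
   its parameters. *)
Inductive form (L : signature) (V : Type) : Type :=
| FEq of term L V & term L V
| FRel (r : rel_sym L) of ('I_(rel_ar r) -> term L V)
| FTop
| FBot
| FAnd of form L V & form L V
| FOr of form L V & form L V
| FEx (n : nat) of form L ('I_n + V).
Arguments FEq {L V}.
Arguments FRel {L V}.
Arguments FTop {L V}.
Arguments FBot {L V}.
Arguments FAnd {L V}.
Arguments FOr {L V}.
Arguments FEx {L V}.

Fixpoint term_rename (L : signature) (V W : Type) (r : V -> W) (t : term L V) :
    term L W :=
  match t with
  | Var x => Var (r x)
  | App f ts => App f (fun i => term_rename r (ts i))
  end.

Fixpoint rename (L : signature) (V W : Type) (r : V -> W) (phi : form L V) :
    form L W :=
  match phi with
  | FEq s t => FEq (term_rename r s) (term_rename r t)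
  | FRel R ts => FRel R (fun i => term_rename r (ts i))
  | FTop => FTop
  | FBot => FBot
  | FAnd p q => FAnd (rename r p) (rename r q)
  | FOr p q => FOr (rename r p) (rename r q)
  | FEx n p => FEx n (rename (copair inl (inr \o r)) p)
  end.

Record structure (L : signature) := Structure {
  carrier :> Type;
  carrier_inhabited : inhabited carrier;
  fun_int : forall f : fun_sym L, ('I_(fun_ar f) -> carrier) -> carrier;
  rel_int : forall r : rel_sym L, ('I_(rel_ar r) -> carrier) -> Prop }.

Fixpoint eval (L : signature) (M : structure L) (V : Type) (v : V -> M)
    (t : term L V) : M :=
  match t with
  | Var x => v x
  | App f ts => fun_int (fun i => eval v (ts i))
  end.

Fixpoint sat (L : signature) (M : structure L) (V : Type) (v : V -> M)
    (phi : form L V) : Prop :=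
  match phi with
  | FEq s t => eval v s = eval v t
  | FRel R ts => rel_int (fun i => eval v (ts i))
  | FTop => True
  | FBot => False
  | FAnd p q => sat v p /\ sat v q
  | FOr p q => sat v p \/ sat v q
  | FEx n p => exists w : 'I_n -> M, sat (copair w v) p
  end.

(* [HInd p q] is the sentence forall x (p(x) -> q(x)). *)
Record hind (L : signature) := HInd {
  hind_arity : nat;
  hind_lhs : form L 'I_hind_arity;
  hind_rhs : form L 'I_hind_arity }.

Definition theory (L : signature) := set (hind L).

Definition models (L : signature) (M : structure L) (T : theory L) : Prop :=
  forall s, T s -> forall v : 'I_(hind_arity s) -> M,
    sat v (hind_lhs s) -> sat v (hind_rhs s).

Definition is_hom (L : signature) (M N : structure L) (h : M -> N) : Prop :=
  (forall (f : fun_sym L) (a : 'I_(fun_ar f) -> M),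
     h (fun_int a) = fun_int (h \o a)) /\
  (forall (r : rel_sym L) (a : 'I_(rel_ar r) -> M),
     rel_int a -> rel_int (h \o a)).

Definition is_automorphism (L : signature) (M : structure L) (h : M -> M) :
    Prop :=
  is_hom h /\ exists g : M -> M, [/\ is_hom g, cancel h g & cancel g h].

Definition joint_continuation (L : signature) (T : theory L) : Prop :=
  forall M1 M2 : structure L, models M1 T -> models M2 T ->
  exists (N : structure L) (h1 : M1 -> N) (h2 : M2 -> N),
    [/\ models N T, is_hom h1 & is_hom h2].

(* psi is a negation of phi modulo T *)
Definition negation (L : signature) (T : theory L) (V : Type)
    (phi psi : form L V) : Prop :=
  forall M : structure L, models M T -> ~ exists v : V -> M, sat v (FAnd phi psi).

Definition existentially_closed (L : signature) (T : theory L)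
    (M : structure L) : Prop :=
  models M T /\
  forall (n : nat) (phi : form L 'I_n) (a : 'I_n -> M), ~ sat a phi ->
    exists psi : form L 'I_n, negation T phi psi /\ sat a psi.

(* A set A is small (with respect to K) when its cardinality is less than that
   of the type K. *)
Definition small (K : Type) (I : Type) (A : set I) : Prop :=
  ~ ([set: K] #<= A)%card.

(* The cardinality of K is a strong limit and exceeds the number of formulas,
   which is the maximum of |L| and aleph_0. *)
Definition strong_limit_above (L : signature) (K : Type) : Prop :=
  small K [set: form L nat] /\
  forall (I : Type) (A : set I), small K A -> small K [set B | B `<=` A].

Definition satisfiable (L : signature) (M : structure L) (V : Type)
    (S : set (form L (V + M))) : Prop :=
  exists v : V -> M, forall phi, S phi -> sat (copair v id) phi.

Definition finitely_satisfiable (L : signature) (M : structure L) (V : Type)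
    (S : set (form L (V + M))) : Prop :=
  forall S0, S0 `<=` S -> finite_set S0 -> satisfiable S0.

Definition very_saturated (L : signature) (K : Type) (M : structure L) : Prop :=
  forall (V : Type) (S : set (form L (V + M))),
    small K S -> finitely_satisfiable S -> satisfiable S.

Definition same_type (L : signature) (M : structure L) (A : set M) (I : Type)
    (a b : I -> M) : Prop :=
  forall phi : form L (I + A),
    sat (copair a (fun p : A => val p)) phi <->
    sat (copair b (fun p : A => val p)) phi.

Definition very_homogeneous (L : signature) (K : Type) (M : structure L) :
    Prop :=
  forall (A : set M) (I : Type) (a b : I -> M), small K A -> small K [set: I] ->
    same_type A a b <->
    exists h : M -> M,
      [/\ is_automorphism h, forall c, A c -> h c = c & forall i, h (a i) = b i].

Definition monster (L : signature) (T : theory L) (K : Type) (M : structure L) :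
    Prop :=
  [/\ strong_limit_above L K, existentially_closed T M,
      very_homogeneous K M & very_saturated K M].

(* phi(x, a), as a formula over M *)
Definition inst (L : signature) (M : structure L) (n m : nat)
    (phi : form L ('I_n + 'I_m)) (a : 'I_m -> M) : form L ('I_n + M) :=
  rename (copair inl (inr \o a)) phi.

(* phi(x, y_1) and phi(x, y_2), as formulas in x, y_1, y_2 *)
Definition at1 (L : signature) (n m : nat) (phi : form L ('I_n + 'I_m)) :
    form L ('I_n + ('I_m + 'I_m)) :=
  rename (copair inl (inr \o inl)) phi.

Definition at2 (L : signature) (n m : nat) (phi : form L ('I_n + 'I_m)) :
    form L ('I_n + ('I_m + 'I_m)) :=
  rename (copair inl (inr \o inr)) phi.

(* exists x (phi(x, y_1) /\ phi(x, y_2)) *)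
Definition ex_and2 (L : signature) (n m : nat) (phi : form L ('I_n + 'I_m)) :
    form L ('I_m + 'I_m) :=
  FEx n (FAnd (at1 phi) (at2 phi)).

(* exists x (phi(x, y_1) /\ ... /\ phi(x, y_k)); the variable (i, j) is the
   j-th entry of y_(i+1) *)
Definition ex_andk (L : signature) (k n m : nat) (phi : form L ('I_n + 'I_m)) :
    form L ('I_k * 'I_m) :=
  FEx n (\big[FAnd/FTop]_(i < k)
           rename (copair inl (fun j => inr (i, j))) phi).

Definition incomparable (X : eqType) (s t : seq X) : bool :=
  ~~ prefix s t && ~~ prefix t s.

Section Properties.
Variables (L : signature) (T : theory L) (M : structure L).

Definition formula_OP (n m : nat) (phi : form L ('I_n + 'I_m)) : Prop :=
  exists (a : nat -> 'I_n -> M) (b : nat -> 'I_m -> M)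
         (psi : form L ('I_n + 'I_m)),
  [/\ negation T phi psi,
      forall i j : nat, i < j -> sat (copair (a i) (b j)) phi &
      forall i j : nat, i >= j -> sat (copair (a i) (b j)) psi].

Definition formula_IP (n m : nat) (phi : form L ('I_n + 'I_m)) : Prop :=
  exists (a : nat -> 'I_n -> M) (c : (nat -> bool) -> 'I_m -> M)
         (psi : form L ('I_n + 'I_m)),
  [/\ negation T phi psi,
      forall i sigma, sigma i = true -> sat (copair (a i) (c sigma)) phi &
      forall i sigma, sigma i = false -> sat (copair (a i) (c sigma)) psi].

Definition formula_TP (k n m : nat) (phi : form L ('I_n + 'I_m)) : Prop :=
  exists (a : seq nat -> 'I_m -> M) (psi : form L ('I_k * 'I_m)),
  [/\ negation T (ex_andk k phi) psi,
      forall sigma : nat -> nat,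
        satisfiable (range (fun l => inst phi (a (mkseq sigma l)))) &
      forall (eta : seq nat) (i : 'I_k -> nat),
        (forall p q : 'I_k, p < q -> i p < i q) ->
        sat (fun v => a (rcons eta (i v.1)) v.2) psi].

Definition formula_TP1 (n m : nat) (phi : form L ('I_n + 'I_m)) : Prop :=
  exists (a : seq nat -> 'I_m -> M) (psi : form L ('I_m + 'I_m)),
  [/\ negation T (ex_and2 phi) psi,
      forall sigma : nat -> nat,
        satisfiable (range (fun l => inst phi (a (mkseq sigma l)))) &
      forall mu eta : seq nat, incomparable mu eta ->
        sat (copair (a mu) (a eta)) psi].

Definition formula_TP2 (k n m : nat) (phi : form L ('I_n + 'I_m)) : Prop :=
  exists (a : nat -> nat -> 'I_m -> M) (psi : form L ('I_k * 'I_m)),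
  [/\ negation T (ex_andk k phi) psi,
      forall sigma : nat -> nat,
        satisfiable (range (fun i => inst phi (a i (sigma i)))) &
      forall (i : nat) (j : 'I_k -> nat),
        (forall p q : 'I_k, p < q -> j p < j q) ->
        sat (fun v => a i (j v.1) v.2) psi].

Definition formula_SOP1 (n m : nat) (phi : form L ('I_n + 'I_m)) : Prop :=
  exists (a : seq bool -> 'I_m -> M) (psi : form L ('I_m + 'I_m)),
  [/\ negation T (ex_and2 phi) psi,
      forall sigma : nat -> bool,
        satisfiable (range (fun l => inst phi (a (mkseq sigma l)))) &
      forall mu eta : seq bool, prefix (rcons mu false) eta ->
        sat (copair (a (rcons mu true)) (a eta)) psi].

Definition formula_SOP2 (n m : nat) (phi : form L ('I_n + 'I_m)) : Prop :=
  exists (a : seq bool -> 'I_m -> M) (psi : form L ('I_m + 'I_m)),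
  [/\ negation T (ex_and2 phi) psi,
      forall sigma : nat -> bool,
        satisfiable (range (fun l => inst phi (a (mkseq sigma l)))) &
      forall mu eta : seq bool, incomparable mu eta ->
        sat (copair (a mu) (a eta)) psi].

Definition some_formula
    (P : forall n m : nat, form L ('I_n + 'I_m) -> Prop) : Prop :=
  exists (n m : nat) (phi : form L ('I_n + 'I_m)), P n m phi.

Definition has_OP : Prop := some_formula formula_OP.
Definition has_IP : Prop := some_formula formula_IP.
Definition has_TP (k : nat) : Prop := some_formula (formula_TP k).
Definition has_TP1 : Prop := some_formula formula_TP1.
Definition has_TP2 (k : nat) : Prop := some_formula (formula_TP2 k).
Definition has_SOP1 : Prop := some_formula formula_SOP1.
Definition has_SOP2 : Prop := some_formula formula_SOP2.

Definition has_SOP3 : Prop :=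
  exists (n m : nat) (phi0 phi1 : form L ('I_n + 'I_m))
         (a : nat -> 'I_m -> M) (psi : form L ('I_m + 'I_m)),
  [/\ negation T (FEx n (FAnd (at2 phi0) (at1 phi1))) psi,
      forall k : nat,
        satisfiable ([set inst phi0 (a i) | i in [set i | i < k]] `|`
                     [set inst phi1 (a j) | j in [set j | j >= k]]) &
      forall i j : nat, i < j -> sat (copair (a i) (a j)) psi].

End Properties.

(* Main.v *)
From Stdlib Require List.
Require Import Defs.
From mathcomp Require Import all_boot zify.
From mathcomp Require Import boolp classical_sets functions cardinality wochoice.

Set Implicit Arguments.
Unset Strict Implicit.
Unset Printing Implicit Defensive.

Local Open Scope classical_set_scope.

(** All implications except those from 2-TP to OP and from k-TP to 2-TP are
    explicit constructions.  Trees are re-indexed: [omega^{<omega}] is sent into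
    [2^{<omega}] by [(i_1, i_2, ...) |-> 0^{i_1} 1 0^{i_2} 1 ...], which respects
    extension and incomparability and turns siblings into the pairs that SOP1
    speaks of; an array becomes a tree by keeping only the length and the last
    entry of a node.  Formulas are changed by passing to pairs of parameters:
    for TP2 to IP, the formula says that [x] chooses the second of two
    inconsistent parameters, and its negation that [x] chooses the first.  For
    SOP3 to SOP2 the parameters are the end points of an interval, the formula
    says that the cut realised by [x] lies in this interval, and a binary tree
    of nested and disjoint intervals gives SOP2; such a tree has finite depth
    inside [omega], and saturation makes it infinite.

    The two remaining implications are of another kind.  Elements that do not
    satisfy a positive formula satisfy some negation of it, but which one
    depends on them, so a uniform negation has to be won from among the many
    formulas of the language by a partition argument on a large configuration.
    The notion that makes large configurations available is [extendable]: a set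
    [A] of parameters is extendable when arbitrarily large finite pieces of a
    tree with inconsistent siblings exist whose branches are consistent together
    with any finitely many instances over [A].  The empty set is extendable for
    a formula with k-TP, and by saturation ([widen]) an extendable set of bounded
    size has as many inconsistent one-point extensions as desired, all of them
    extendable.

    From 2-TP to OP ([TP_OP]): one builds by well-founded recursion a long
    sequence of pairs [(a_i, c_i)] where [c_i] satisfies [phi(x, a_j)] for all
    [j <= i], while [phi(c_j, a_i)] fails for [j < i]; the latter is possible
    since each earlier [c_j] satisfies the formula for at most one of the
    pairwise inconsistent candidates for [a_i].  Each failure is witnessed by a
    negation of [phi], and the Erdos-Rado theorem for pairs
    ([erdos_rado_pairs]) gives an infinite subsequence on which the negation
    is always the same.

    From k-TP to 2-TP ([TP_reduce]) it is enough to lower [k >= 3].  Consider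
    one-point extensions [b_n] of an extendable set [A], inconsistent in the
    sense of k-TP.  If two of them can be added to [A] together, then pairs of
    them are inconsistent in the sense of uphalf(k)-TP.  If not, this is due to
    finitely many elements of [A], to a finite piece of tree and to a negation
    of the positive formula which says that such a piece exists over both;
    taking the whole piece of tree as the new tuple [x] makes the two
    extensions 2-inconsistent.  By Erdos-Rado the same reason applies along an
    infinite sequence of extensions.  Hence [A] splits according to one of
    fewer than |K| patterns.  If no pattern gave TP, each would have a finite
    bound on the number of times it can be iterated, and Zorn's lemma
    ([stable_set]) would provide an [A] where no finite extension lowers any
    of these bounds; but if the bound for a pattern is the same for [A] and for
    the members of a splitting of [A], then it is not a bound for [A]. *)

(** * Bounded types and well-orders *)

Definition embeds (X Y : Type) : Prop := exists f : X -> Y, injective f.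

Lemma embeds_trans (Y X Z : Type) : embeds X Y -> embeds Y Z -> embeds X Z.
Proof.
by move=> [f fI] [g gI]; exists (g \o f) => x x' /gI/fI.
Qed.

Lemma embeds_set (X : Type) : embeds X (set X).
Proof.
by exists set1 => x y e; have : [set y] x by rewrite -e.
Qed.

Lemma embeds_set2 (X Y : Type) : embeds X Y -> embeds (set X) (set Y).
Proof.
move=> [f fI]; exists (fun A => f @` A) => A B e; apply/seteqP; split=> x Ax.
  have : (f @` B) (f x) by rewrite -e; exists x.
  by case=> y By /fI <-.
have : (f @` A) (f x) by rewrite e; exists x.
by case=> y By /fI <-.
Qed.

(** Kuratowski's ordered pairs. *)
Lemma embeds_pair (X : Type) : embeds (X * X) (set (set X)).
Proof.
exists (fun p => [set [set p.1]; [set p.1; p.2]]) => -[a b] [c d] /= e.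
have ac : a = c.
  have : [set [set c]; [set c; d]] [set a] by rewrite -e; left.
  case=> e1; first by have : [set c] a by rewrite -e1.
  by have -> : c = a by have : [set a] c by rewrite e1; left.
subst c; congr (_, _).
have : [set [set a]; [set a; d]] [set a; b] by rewrite -e; right.
have : [set [set a]; [set a; b]] [set a; d] by rewrite e; right.
case=> e1; case=> e2.
- have -> : b = a by have : [set a] b by rewrite -e2; right.
  by have -> : d = a by have : [set a] d by rewrite -e1; right.
- have da : d = a by have : [set a] d by rewrite -e1; right.
  by subst d; have : [set a; a] b by [rewrite -e2; right]; case.
- have ba : b = a by have : [set a] b by rewrite -e2; right.
  by subst b; have : [set a; a] d by [rewrite -e1; right]; case.
- have : [set a; d] b by rewrite -e2; right.
  case=> //= ba; subst b; have : [set a; a] d by rewrite -e1; right.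
  by case.
Qed.

(** The presence of the empty set marks the right summand. *)
Lemma embeds_sum (X : Type) : embeds (X + X) (set (set X)).
Proof.
exists (fun s => match s with
  | inl x => [set [set x]] | inr x => [set [set x]; set0] end).
have n0 (x : X) : set0 <> [set x] by move=> e; have : set0 x by rewrite e.
have key (x y : X) : [set x] = [set y] \/ [set x] = set0 -> x = y.
  by case=> [e|/esym/n0//]; have : [set y] x by rewrite -e.
case=> x; case=> y /= e.
- have h : [set [set y]] [set x] by rewrite -e.
  by congr inl; apply: key; left.
- by have /n0 : [set [set x]] set0 by rewrite e; right.
- by have /n0 : [set [set y]] set0 by rewrite -e; right.
- have h : [set [set y]; set0] [set x] by rewrite -e; left.
  by congr inr; apply: key.
Qed.

Lemma Cantor (X : Type) : ~ embeds (set X) X.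
Proof.
move=> [f fI]; pose D := [set x | exists2 A, f A = x & ~ A x].
have [DD|nDD] := EM (D (f D)); first by case: (DD) => A /fI ->.
by apply: (nDD); exists D.
Qed.

Fixpoint tower (F : Type) (n : nat) : Type :=
  if n is n'.+1 then set (tower F n') else F.

(** The iterated power sets of [F] stand for the cardinals below
    beth_omega(|F|).  For [F] the formulas of the language they are all small,
    since [K] is a strong limit, and the closure properties below come from
    explicit injections, without any cardinal arithmetic. *)
Definition bounded (F X : Type) : Prop := exists n, embeds X (tower F n).

Section Bounded.
Variable F : Type.

Lemma tower_mono n p : n <= p -> embeds (tower F n) (tower F p).
Proof.
move=> /subnK <-; elim: (p - n) => [|d IH]; first by exists id.
exact: embeds_trans IH (@embeds_set _).
Qed.

Lemma bounded_embeds X Y : embeds X Y -> bounded F Y -> bounded F X.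
Proof. by move=> XY [n Yn]; exists n; apply: embeds_trans XY Yn. Qed.

Lemma bounded_base : bounded F F.
Proof. by exists 0; exists id. Qed.

Lemma bounded_set X : bounded F X -> bounded F (set X).
Proof. by move=> [n Xn]; exists n.+1; apply: embeds_set2. Qed.

Lemma bounded_common X Y : bounded F X -> bounded F Y ->
  exists n, embeds X (tower F n) /\ embeds Y (tower F n).
Proof.
move=> [n Xn] [p Yp]; exists (maxn n p); split.
  exact: embeds_trans Xn (tower_mono (leq_maxl _ _)).
exact: embeds_trans Yp (tower_mono (leq_maxr _ _)).
Qed.

Lemma bounded_prod X Y : bounded F X -> bounded F Y -> bounded F (X * Y).
Proof.
move=> bX bY; have [n [[f fI] [g gI]]] := bounded_common bX bY.
exists n.+2; apply: embeds_trans (@embeds_pair _).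
by exists (fun p => (f p.1, g p.2)) => -[a b] [c d] [/fI -> /gI ->].
Qed.

Lemma bounded_sum X Y : bounded F X -> bounded F Y -> bounded F (X + Y).
Proof.
move=> bX bY; have [n [[f fI] [g gI]]] := bounded_common bX bY.
exists n.+2; apply: embeds_trans (@embeds_sum _).
exists (fun s => match s with inl x => inl (f x) | inr y => inr (g y) end).
by move=> [x|x] [y|y] //= [] => [/fI ->|/gI ->].
Qed.

Lemma bounded_fun X Y : bounded F X -> bounded F Y -> bounded F (X -> Y).
Proof.
move=> bX bY; apply: bounded_embeds (bounded_set (bounded_prod bX bY)).
exists (fun f => [set p | p.2 = f p.1]) => f g e; apply/funext => x.
by have : [set p | p.2 = g p.1] (x, f x) by rewrite -e.
Qed.

Hypothesis bnat : embeds nat F.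

Lemma bounded_nat : bounded F nat.
Proof. by exists 0. Qed.

Lemma bounded_count (X : countType) : bounded F X.
Proof.
apply: bounded_embeds bounded_nat.
by exists pickle; apply: pcan_inj (@pickleK _).
Qed.

Lemma bounded_seq X : bounded F X -> bounded F (seq X).
Proof.
move=> bX.
apply: (@bounded_embeds _ (nat -> option X)).
  exists (fun s => onth s) => s t e.
  elim: s t e => [|x s IH] [|y t] e //=; first by move/(congr1 (@^~ 0)): e.
    by move/(congr1 (@^~ 0)): e.
  move: (congr1 (@^~ 0) e) => /= -[->]; congr cons.
  by apply: IH; apply/funext => i; move/(congr1 (@^~ i.+1)): e.
apply: bounded_fun; first exact: bounded_nat.
apply: (@bounded_embeds _ (unit + X)).
  by exists (fun o => if o is Some x then inr x else inl tt) => -[x|] [y|] // [->].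
by apply: bounded_sum bX; apply: bounded_count.
Qed.

End Bounded.

Definition strict_wo (W : Type) (lt : W -> W -> Prop) : Prop :=
  [/\ well_founded lt, forall u v w, lt u v -> lt v w -> lt u w &
      forall u v, [\/ lt u v, u = v | lt v u]].

Lemma strict_wo_irr W (lt : W -> W -> Prop) u : strict_wo lt -> ~ lt u u.
Proof.
move=> [wf _ _]; by elim/(well_founded_ind wf): u => u IH uu; apply: (IH u).
Qed.

(** Zermelo's theorem, with the order turned into a well-founded strict one. *)
Lemma well_ordering (W : Type) : exists lt : W -> W -> Prop, strict_wo lt.
Proof.
have [R wo] := well_ordering_principle {classic W}.
have ex (A : set W) : A !=set0 -> exists z, A z /\ forall x, A x -> R z x.
  move=> [x Ax]; have [|z [[zA lz] _]] := wo (fun x => `[< A x >]).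
    by exists x; apply/asboolP.
  exists z; split; first by apply/asboolP.
  by move=> y Ay; apply: lz; apply/asboolP.
have refl (x : W) : R x x.
  by have [w [-> wl]] := ex [set x] (ex_intro _ x erefl); apply: wl.
have uq (x y : W) : R x y -> R y x -> x = y.
  move=> xy yx; have [|z [_ zu]] := wo (fun z : W => `[< z = x \/ z = y >]).
    by exists x; apply/asboolP; left.
  transitivity z; [symmetry|]; apply: zu; split.
  - by apply/asboolP; left.
  - by move=> w /asboolP [->|->].
  - by apply/asboolP; right.
  - by move=> w /asboolP [->|->].
have tot (x y : W) : R x y \/ R y x.
  have [z [[->|->] zl]] := ex [set x; y] (ex_intro _ x (or_introl erefl)).
    by left; apply: zl; right.
  by right; apply: zl; left.
exists (fun u v => ~ R v u); split.
- move=> u; apply: contrapT => nA.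
  have [z [nz zl]] := ex [set u | ~ Acc (fun u v => ~ R v u) u] (ex_intro _ u nA).
  apply: nz; constructor => y nzy; apply: contrapT => nAy.
  exact: nzy (zl _ nAy).
- move=> u v w vu wv wu.
  have [z [zA zl]] := ex [set u; v; w] (ex_intro _ u (or_introl (or_introl erefl))).
  have zu : R z u by apply: zl; left; left.
  have zv : R z v by apply: zl; left; right.
  have zw : R z w by apply: zl; right.
  have {zA} [e|[e|e]] : z = u \/ z = v \/ z = w by case: zA => [[]|]; auto.
  - by apply: wv; rewrite (uq w u) -?e // e.
  - by apply: vu; rewrite -e.
  - by apply: wv; rewrite -e.
- move=> u v; have [uv|uv] := EM (R u v); have [vu|vu] := EM (R v u).
  + by constructor 2; apply: uq.
  + by constructor 1.
  + by constructor 3.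
  + by case: (tot u v).
Qed.

(** * The Erdos-Rado theorem for pairs *)

Section ErdosRado.
Variables (C W : Type) (lt : W -> W -> Prop) (f : W -> W -> C).
Hypothesis wo : strict_wo lt.

Let wf : well_founded lt. Proof. by case: wo. Qed.
Let trans : forall u v w, lt u v -> lt v w -> lt u w. Proof. by case: wo. Qed.

Lemma wo_ind (P : W -> Prop) :
  (forall w, (forall u, lt u w -> P u) -> P w) -> forall w, P w.
Proof. exact: well_founded_ind wf P. Qed.

Lemma wo_min (A : set W) : A !=set0 ->
  exists z, A z /\ forall x, A x -> ~ lt x z.
Proof.
move=> [x Ax]; apply: contrapT => nex.
suff : forall w, ~ A w by move/(_ x).
elim/wo_ind => w IH Aw; apply: nex; exists w; split=> // y Ay yw.
exact: IH yw Ay.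
Qed.

(** Picking least elements outside the list of those already picked either
    exhausts [A] or never stops. *)
Lemma wo_sequence (A : set W) :
  (exists s : seq W, forall w, A w -> List.In w s) \/
  exists u : nat -> W, (forall i, A (u i)) /\ forall i j, i < j -> lt (u i) (u j).
Proof.
have [|nfin] := EM (exists s : seq W, forall w, A w -> List.In w s); [by left|right].
have next (s : seq W) : exists w, [/\ A w, ~ List.In w s &
    forall x, A x -> ~ List.In x s -> ~ lt x w].
  have [|w [[Aw sw] wm]] := @wo_min (A `&` [set w | ~ List.In w s]).
    apply: contrapT => h; apply: nfin; exists s => w Aw; apply: contrapT => sw.
    by apply: h; exists w.
  by exists w; split=> // x Ax sx; apply: wm.
have [g gP] := choice next.
pose l := fix l n := if n is n'.+1 then g (l n') :: l n' else [::].
have lmono i j w : i <= j -> List.In w (l i) -> List.In w (l j).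
  move=> /subnK <-; elim: (j - i) => [//|d IH] h; right; exact: IH.
exists (fun n => g (l n)); split=> [i|i j ij]; first by case: (gP (l i)).
have [Aj nj _] := gP (l j); have [_ _ mi] := gP (l i).
case: wo => _ _ /(_ (g (l i)) (g (l j))) [//|e|ji].
  by exfalso; apply: nj; rewrite -e; apply: lmono ij _; left.
exfalso; apply: mi ji => // h; apply: nj.
by apply: lmono (ltnW ij) h.
Qed.

Definition er_step (w : W) (rec : forall u, lt u w -> set W) : set W :=
  [set u | exists h : lt u w, forall v, rec u h v -> f v u = f v w].

(** The Erdos-Rado tree: [u] precedes [w] when [u < w] and [w] cannot be told
    from [u] by the colours of its pairs with the predecessors of [u].  Hence
    the colour of a pair of predecessors of [w] depends only on its smaller
    member. *)
Definition er_pred : W -> set W := Fix wf (fun _ => set W) er_step.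

Lemma er_predE w u :
  er_pred w u <-> lt u w /\ forall v, er_pred u v -> f v u = f v w.
Proof.
rewrite {1}/er_pred Fix_eq; last first.
  move=> x g h gh; suff -> : g = h by [].
  apply: functional_extensionality_dep => v.
  by apply: functional_extensionality_dep => vx; apply: gh.
by rewrite /er_step /=; split=> [[h]|[h]] H; [split|exists h].
Qed.

Lemma er_pred_lt w u : er_pred w u -> lt u w.
Proof. by move=> /er_predE []. Qed.

Lemma er_pred_col w u v : er_pred w u -> er_pred u v -> f v u = f v w.
Proof. by move=> /er_predE [_]; apply. Qed.

Lemma er_pred_trans w u v : er_pred w u -> er_pred u v -> er_pred w v.
Proof.
elim/wo_ind: v w u => v IH w u wu uv; apply/er_predE; split.
  exact: trans (er_pred_lt uv) (er_pred_lt wu).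
move=> z vz; have uz : er_pred u z by apply: IH (er_pred_lt vz) _ _ uv vz.
by rewrite (er_pred_col uv vz) (er_pred_col wu uz).
Qed.

Lemma er_pred_chain w u v : er_pred w u -> er_pred w v -> lt v u -> er_pred u v.
Proof.
elim/wo_ind: v u => v IH u wu wv vu; apply/er_predE; split=> // z vz.
have wz := er_pred_trans wv vz; have zv := er_pred_lt vz.
by rewrite (er_pred_col wv vz) -(er_pred_col wu) //; apply: IH => //; apply: trans vu.
Qed.

(** Of two distinct points with the same predecessors seen in the same
    colours, the smaller one would precede the larger one, hence itself. *)
Lemma er_pred_eq w w' :
  (forall v, er_pred w v <-> er_pred w' v) ->
  (forall v, er_pred w v -> f v w = f v w') -> w = w'.
Proof.
move=> e c; have irr u : ~ lt u u := @strict_wo_irr _ _ u wo.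
case: wo => _ _ /(_ w w') [h|//|h]; exfalso.
  by apply: (irr w); apply: er_pred_lt; apply/e/er_predE.
apply: (irr w'); apply: er_pred_lt; apply/e/er_predE; split=> // v v'.
by rewrite c //; apply/e.
Qed.

(** The predecessors of [w] that [w] sees in a given colour form a homogeneous
    set, so they are finitely many if there is no infinite homogeneous
    sequence.  Numbering them inside each colour embeds the predecessors of [w]
    in [C * nat].  The image with the order carried over from [W] determines
    [w]: going up along two chains with the same image, each point is determined
    by the previous ones ([er_pred_eq]).  So [W] embeds in the set of relations
    on [C * nat]. *)
Lemma erdos_rado_pairs :
  ~ embeds W (set ((C * nat) * (C * nat))) ->
  exists (rho : C) (u : nat -> W), forall i j, i < j ->
    lt (u i) (u j) /\ f (u i) (u j) = rho.
Proof.
move=> big; apply: contrapT => nex; apply: big.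
have fin w c : exists s : seq W,
    forall v, er_pred w v /\ f v w = c -> List.In v s.
  have [//|[u [uP ui]]] := wo_sequence [set v | er_pred w v /\ f v w = c].
  exfalso; apply: nex; exists c, u => i j ij; split; first exact: ui.
  have [wi <-] := uP i; have [wj _] := uP j.
  exact: er_pred_col wj (er_pred_chain wj wi (ui _ _ ij)).
have /choice [g gP] : forall p : W * C, exists s : seq W,
    forall v, er_pred p.1 v /\ f v p.1 = p.2 -> List.In v s.
  by move=> [w c]; apply: fin.
pose idx (w v : W) : C * nat := (f v w, index (v : {classic W}) (g (w, f v w))).
have InE (v : {classic W}) (s : seq {classic W}) : List.In (v : W) s -> v \in s.
  elim: s => [//|x s IH] /= [->|/IH h]; first by rewrite mem_head.
  by rewrite inE h orbT.
have idxI w u v : er_pred w u -> er_pred w v -> idx w u = idx w v -> u = v.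
  move=> wu wv [ec]; rewrite ec => ei.
  have us : (u : {classic W}) \in (g (w, f v w) : seq {classic W}).
    by apply: InE; apply: (gP (w, f v w)).
  have vs : (v : {classic W}) \in (g (w, f v w) : seq {classic W}).
    by apply: InE; apply: (gP (w, f v w)).
  by rewrite -(nth_index (u : {classic W}) us) ei nth_index.
pose code w := [set p | exists u v, [/\ er_pred w u, er_pred w v, p = (idx w u, idx w v)
  & u = v \/ lt u v]].
exists code => w w' e.
have half (x y : W) : code x = code y -> forall v, er_pred x v ->
    exists v', er_pred y v' /\ idx x v = idx y v'.
  move=> exy v xv; have : code x (idx x v, idx x v) by exists v, v; split=> //; left.
  by rewrite exy => -[u [u' [yu _ /(congr1 fst) ii _]]]; exists u.
have lt_code (x y : W) u v u' v' : code x = code y -> er_pred x u -> er_pred x v ->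
   er_pred y u' -> er_pred y v' -> idx x u = idx y u' -> idx x v = idx y v' ->
   lt u v -> lt u' v'.
  move=> exy xu xv yu yv eu ev uv.
  have : code x (idx x u, idx x v) by exists u, v; split=> //; right.
  rewrite exy => -[a [b [ya yb eab ab]]].
  have /= ea := congr1 fst eab; have /= eb := congr1 snd eab.
  have ea' : u' = a by apply: (idxI y) => //; rewrite -eu.
  have eb' : v' = b by apply: (idxI y) => //; rewrite -ev.
  rewrite -ea' -eb' in ab; case: ab => // e1; exfalso.
  have euv : u = v by apply: (idxI x) => //; rewrite eu ev e1.
  by apply: (@strict_wo_irr W lt v wo); rewrite -{1}euv.
have same v v' : er_pred w v -> er_pred w' v' -> idx w v = idx w' v' -> v = v'.
  elim/wo_ind: v v' => v IH v' wv wv' ei.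
  have sub (z : W) : er_pred v z <-> er_pred v' z.
    split=> vz.
      have wz := er_pred_trans wv vz; have [z' [wz' ez]] := half _ _ e _ wz.
      have zz : z = z' by apply: IH => //; apply: er_pred_lt.
      rewrite zz; apply: (er_pred_chain wv' wz').
      exact: (lt_code w w' _ _ _ _ e wz wv wz' wv' ez ei (er_pred_lt vz)).
    have wz := er_pred_trans wv' vz; have [z' [wz' ez]] := half _ _ (esym e) _ wz.
    have zv : lt z' v.
      exact: (lt_code w' w _ _ _ _ (esym e) wz wv' wz' wv ez (esym ei) (er_pred_lt vz)).
    have zz : z' = z by apply: IH.
    by rewrite -zz; apply: er_pred_chain wv wz' zv.
  apply: er_pred_eq => // z vz.
  have wz := er_pred_trans wv vz; have wz' : er_pred w' z.
    by apply: (er_pred_trans wv'); apply/sub.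
  rewrite (er_pred_col wv vz) (er_pred_col wv' (proj1 (sub z) vz)).
  have [z' [wz'' ez]] := half _ _ e _ wz.
  have zz : z = z' by apply: IH => //; apply: er_pred_lt.
  by move: ez; rewrite -zz => -[].
apply: er_pred_eq => [v|v wv].
  split=> wv.
    by have [v' [wv' ei]] := half _ _ e _ wv; rewrite (same _ _ wv wv' ei).
  have [v' [wv' ei]] := half _ _ (esym e) _ wv.
  by rewrite -(same _ _ wv' wv (esym ei)).
have [v' [wv' ei]] := half _ _ e _ wv.
by move: (ei); rewrite -(same _ _ wv wv' ei) => -[].
Qed.

End ErdosRado.

Lemma erdos_rado_type (F C : Type) : embeds nat F -> bounded F C ->
  exists (W : Type) (lt : W -> W -> Prop), [/\ bounded F W, strict_wo lt &
    forall f : W -> W -> C, exists (rho : C) (u : nat -> W),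
      forall i j, i < j -> lt (u i) (u j) /\ f (u i) (u j) = rho].
Proof.
move=> Fnat bC; pose W := set (set ((C * nat) * (C * nat))).
have [lt lt_wo] := well_ordering W; exists W, lt; split=> //.
  do 2!apply: bounded_set; have b : bounded F (C * nat).
    by apply: bounded_prod => //; apply: bounded_nat.
  exact: bounded_prod.
by move=> f; apply: erdos_rado_pairs => //; apply: Cantor.
Qed.

(** * Satisfaction, saturation and negations *)

Section Formulas.
Variables (L : signature) (M : structure L).

Lemma eval_rename (V W : Type) (r : V -> W) (v : W -> M) (t : term L V) :
  eval v (term_rename r t) = eval (v \o r) t.
Proof. by elim: t => [x|f ts IH] //=; congr fun_int; apply/funext => i; apply: IH. Qed.

Lemma copair_comp (A B C D : Type) (h : C -> D) (f : A -> C) (g : B -> C) :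
  h \o copair f g = copair (h \o f) (h \o g).
Proof. by apply/funext => -[]. Qed.

Lemma sat_rename (V W : Type) (r : V -> W) (v : W -> M) (phi : form L V) :
  sat v (rename r phi) <-> sat (v \o r) phi.
Proof.
elim: phi W r v => {V} [V s t|V R ts|V|V|V p IHp q IHq|V p IHp q IHq|V n p IH] W r v //=.
- by rewrite !eval_rename.
- have -> : (fun i => eval v (term_rename r (ts i))) = fun i => eval (v \o r) (ts i).
    by apply/funext => i; apply: eval_rename.
  by [].
- by split=> -[/IHp ? /IHq].
- by split=> -[/IHp|/IHq]; tauto.
- split=> -[w h]; exists w; move: h; rewrite IH.
    by rewrite copair_comp; congr sat; apply/funext => -[].
  by rewrite copair_comp; congr sat; apply/funext => -[].
Qed.

Lemma sat_big (V I : Type) (s : seq I) (P : pred I) (F : I -> form L V) (v : V -> M) :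
  sat v (\big[FAnd/FTop]_(i <- s | P i) F i) <->
  forall i, List.In i s -> P i -> sat v (F i).
Proof.
elim: s => [|x s IH]; first by rewrite big_nil.
rewrite big_cons; case: ifP => Px /=; rewrite IH; split.
- by move=> [h1 h2] i [<-|h] // Pi; apply: h2.
- by move=> h; split; [apply: h => //; left | move=> i hi; apply: h; right].
- by move=> h i [e|hi]; [rewrite -e Px | apply: h].
- by move=> h i hi; apply: h; right.
Qed.

Lemma In_mem (T : eqType) (x : T) (s : seq T) : List.In x s <-> x \in s.
Proof.
elim: s => [|y s IH] //=; rewrite inE; split=> [[->|/IH ->]|/orP[/eqP->|/IH]].
- by rewrite eqxx.
- by rewrite orbT.
- by left.
- by right.
Qed.

Lemma sat_bigfin (V : Type) (I : finType) (P : pred I) (F : I -> form L V) (v : V -> M) :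
  sat v (\big[FAnd/FTop]_(i | P i) F i) <-> forall i, P i -> sat v (F i).
Proof.
rewrite sat_big; split=> h i; last by move=> _; apply: h.
by apply: h; apply/In_mem; apply: mem_index_enum.
Qed.

Lemma sat_inst n m (phi : form L ('I_n + 'I_m)) (a : 'I_m -> M) (x : 'I_n -> M) :
  sat (copair x id) (inst phi a) <-> sat (copair x a) phi.
Proof. by rewrite sat_rename copair_comp. Qed.

Lemma sat_ex_and2 n m (phi : form L ('I_n + 'I_m)) (a b : 'I_m -> M) :
  sat (copair a b) (ex_and2 phi) <->
  exists x : 'I_n -> M, sat (copair x a) phi /\ sat (copair x b) phi.
Proof.
rewrite /=; split=> -[x [h1 h2]]; exists x.
  move: h1 h2; rewrite /at1 /at2 !sat_rename !copair_comp.
  by move=> h1 h2; split.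
by rewrite /at1 /at2 !sat_rename !copair_comp.
Qed.

Lemma sat_ex_andk k n m (phi : form L ('I_n + 'I_m)) (a : 'I_k * 'I_m -> M) :
  sat a (ex_andk k phi) <->
  exists x : 'I_n -> M, forall i, sat (copair x (fun j => a (i, j))) phi.
Proof.
have e (x : 'I_n -> M) (i : 'I_k) :
    sat (copair x a) (rename (copair inl (fun j => inr (i, j))) phi) <->
    sat (copair x (fun j => a (i, j))) phi.
  by rewrite sat_rename copair_comp.
rewrite /=; split=> -[x h]; exists x.
  by move=> i; apply/e; move: h; rewrite sat_bigfin; apply.
by rewrite sat_bigfin => i _; apply/e.
Qed.

End Formulas.

Lemma embeds_nat_form (L : signature) : embeds nat (form L nat).
Proof. by exists (fun n => FEq (Var n) (Var n)) => n p []. Qed.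

Section Monster.
Variables (L : signature) (T : theory L) (K : Type) (M : structure L).
Hypothesis hM : monster T K M.

Local Notation F := (form L nat).

Lemma structure_point (N : structure L) : N.
Proof. by have := carrier_inhabited N; rewrite inhabitedE => /cid []. Qed.

Lemma small_tower n : small K [set: tower F n].
Proof.
case: hM => -[K0 Kp] _ _ _; elim: n => [//|n IH] /=.
have := Kp _ _ IH; congr small; apply/seteqP; split=> // A _ x _ //.
Qed.

(** Boundedness of the index type [J] makes the set of formulas small; letting
    constraints be predicates that are merely equivalent to formulas keeps
    formulas out of the applications. *)
Lemma saturation (V J : Type) (P : J -> (V -> M) -> Prop) :
  bounded F J ->
  (forall j, exists phi : form L (V + M), forall v, P j v <-> sat (copair v id) phi) ->
  (forall s : seq J, exists v, forall j, List.In j s -> P j v) ->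
  exists v, forall j, P j v.
Proof.
move=> [n [g gI]] def fs; have [phi phiP] := choice def.
case: hM => _ _ _ /(_ V (range phi)) [|S0 sub fin|v vP].
- move=> KJ; apply: (@small_tower n); apply: card_le_trans KJ _.
  apply: card_le_trans (card_image_le _ _) _.
  have e : (range g #= [set: J])%card by apply: inj_card_eq; move=> x y _ _; apply: gI.
  rewrite -(card_le_eql e); exact: subset_card_le.
- have /choice [h hP] : forall psi : {psi | S0 psi}, exists j, phi j = sval psi.
    by move=> [psi /= /sub [j _ <-]]; exists j.
  have [s sE] := (@finite_seqP {classic form L (V + M)} S0).1 fin.
  have [l lP] : exists l : seq J, forall psi, List.In psi s ->
      S0 psi -> exists j, List.In j l /\ phi j = psi.
    elim: (s) => [|psi s' [l lP]]; first by exists [::].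
    have [Spsi|nS] := EM (S0 psi).
      have [j _ ej] := sub _ Spsi; exists (j :: l) => p [<- _|ps Sp].
        by exists j; split=> //; left.
      by have [i [il ei]] := lP _ ps Sp; exists i; split=> //; right.
    by exists l => p [<-|] // /lP.
  have [v vP] := fs l; exists v => psi Spsi.
  have [|j [jl <-]] := lP psi _ Spsi; last by apply/phiP/vP.
  by apply/(@In_mem {classic form L (V + M)}); move: (Spsi); rewrite {1}sE.
- by exists v => j; apply/phiP/vP; exists j.
Qed.

(** Realisations are found for all constraints that mention finitely many
    given objects, rather than for a finite set of constraints; [supp j] lists
    the objects mentioned by [P j]. *)
Lemma saturation_stages (V J Z : Type) (P : J -> (V -> M) -> Prop) (supp : J -> seq Z) :
  bounded F J ->
  (forall j, exists phi : form L (V + M), forall v, P j v <-> sat (copair v id) phi) ->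
  (forall s : seq Z, exists v, forall j, List.incl (supp j) s -> P j v) ->
  exists v, forall j, P j v.
Proof.
move=> bJ def st; apply: saturation => // s.
have [v vP] := st (flatten (map supp s)); exists v => j js; apply: vP => z zj.
elim: s js => [//|i s IH] /= [e|/IH h]; apply/List.in_or_app.
  by left; rewrite e.
by right.
Qed.

(** Existential closedness speaks of variables in an ordinal type; negations
    are needed for variables in any finite type. *)
Lemma ec_negation (V : finType) (phi : form L V) (a : V -> M) : ~ sat a phi ->
  exists psi : form L V, negation T phi psi /\ sat a psi.
Proof.
case: hM => _ [MT ec] _ _ nphi.
have [|psi [neg psiP]] := ec #|V| (rename enum_rank phi) (a \o enum_val).
  rewrite sat_rename => h; apply: nphi; congr sat: h.
  by apply/funext=> x /=; rewrite enum_rankK.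
exists (rename enum_val psi); split; last by rewrite sat_rename.
move=> N NT [v /= [h1 /sat_rename h2]].
apply: (neg N NT); exists (v \o enum_val); split=> //=.
rewrite sat_rename; congr sat: h1; apply/funext=> x /=; by rewrite enum_rankK.
Qed.

Lemma definable_sat (V U : Type) (r : U -> V + M) (phi : form L U) :
  exists psi : form L (V + M), forall v,
    sat (copair v id \o r) phi <-> sat (copair v id) psi.
Proof. by exists (rename r phi) => v; rewrite sat_rename. Qed.

Lemma definable_rename (V U : Type) (r : U -> V) (phi : form L U) :
  exists psi : form L (V + M), forall v, sat (v \o r) phi <-> sat (copair v id) psi.
Proof. by exists (rename (inl \o r) phi) => v; rewrite sat_rename. Qed.

Lemma definable_imp (V : Type) (Q : Prop) (P : (V -> M) -> Prop) :
  (exists psi : form L (V + M), forall v, P v <-> sat (copair v id) psi) ->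
  exists psi : form L (V + M), forall v, (Q -> P v) <-> sat (copair v id) psi.
Proof.
move=> [psi h]; have [q|nq] := EM Q; last by exists FTop.
by exists psi => v; rewrite -h; split=> // /(_ q).
Qed.

End Monster.

(** * Re-indexing trees and pairing parameters *)

(** The node [0^{i_1} 1 0^{i_2} 1 ...] of the binary tree that represents the
    node [(i_1, i_2, ...)]. *)
Definition comb (s : seq nat) : seq bool :=
  flatten [seq rcons (nseq i false) true | i <- s].

Lemma comb_cat s t : comb (s ++ t) = comb s ++ comb t.
Proof. by rewrite /comb map_cat flatten_cat. Qed.

Lemma comb_cons i s : comb (i :: s) = nseq i false ++ true :: comb s.
Proof. exact: cat_rcons. Qed.

Lemma comb_rcons s i : comb (rcons s i) = rcons (comb s ++ nseq i false) true.
Proof. by rewrite -[rcons s i]cats1 comb_cat comb_cons -cats1 catA. Qed.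

Lemma size_comb s : size s <= size (comb s).
Proof.
elim: s => [//|i s IH]; rewrite comb_cons size_cat /= addnS ltnS.
exact: leq_trans IH (leq_addl _ _).
Qed.

Lemma prefix_comb s t : prefix (comb s) (comb t) -> prefix s t.
Proof.
elim: s t => [|i s IH] t; first by rewrite !prefix0s.
case: t => [|j t].
  by rewrite prefixs0 -size_eq0 => /eqP h; move: (size_comb (i :: s)); rewrite h.
rewrite !comb_cons => h.
have [e h'] : i = j /\ prefix (comb s) (comb t).
  by elim: i j h => [|i IHi] [|j] //= /IHi [->].
by rewrite prefix_cons e eqxx IH.
Qed.

(** For [i < j] the representative of the child [j] lies above the
    0-successor of the node whose 1-successor represents the child [i], which
    is the configuration of SOP1. *)
Lemma comb_sibling s i j : i < j ->
  prefix (rcons (comb s ++ nseq i false) false) (comb (rcons s j)).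
Proof.
move=> ij; rewrite comb_rcons -(subnKC ij) addSnnS nseqD /=.
by rewrite -cat_rcons -!cats1 -!catA; apply/prefixP; eexists; rewrite -!catA.
Qed.

Lemma branch_limit (u : nat -> seq bool) :
  (forall l, prefix (u l) (u l.+1)) -> (forall l, l <= size (u l)) ->
  exists tau : nat -> bool, forall l, u l = mkseq tau (size (u l)).
Proof.
move=> up us; exists (fun i => nth false (u i.+1) i) => l.
have mono i j : i <= j -> prefix (u i) (u j).
  move=> /subnK <-; elim: (j - i) => [|d IH]; first exact: prefix_refl.
  exact: prefix_trans IH (up _).
apply: (@eq_from_nth _ false); first by rewrite size_mkseq.
move=> i il; rewrite nth_mkseq //.
have [h|h] := leqP l i.+1.
  by have /prefixP[w ->] := mono _ _ h; rewrite nth_cat il.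
by have /prefixP[w ->] := mono _ _ (ltnW h); rewrite nth_cat us.
Qed.

Lemma prefix_mkseq (X : Type) (sigma : nat -> X) l p : l <= p ->
  exists t, mkseq sigma p = mkseq sigma l ++ t.
Proof.
move=> /subnKC <-; exists [seq sigma i | i <- iota l (p - l)].
by rewrite /mkseq iotaD map_cat.
Qed.

Lemma comb_branch (sigma : nat -> nat) : exists tau : nat -> bool,
  forall l, comb (mkseq sigma l) = mkseq tau (size (comb (mkseq sigma l))).
Proof.
apply: (@branch_limit (fun l => comb (mkseq sigma l))) => l.
  by have [t ->] := prefix_mkseq sigma (leqnSn l); rewrite comb_cat prefix_prefix.
by rewrite -{1}(size_mkseq sigma l) size_comb.
Qed.

Definition increasing k (i : 'I_k -> nat) := forall p q : 'I_k, p < q -> i p < i q.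

Definition join_tuple (X : Type) m (a b : 'I_m -> X) (i : 'I_(m + m)) : X :=
  match fintype.split i with inl j => a j | inr j => b j end.

Lemma join_lshift X m (a b : 'I_m -> X) : join_tuple a b \o @lshift m m = a.
Proof. by apply/funext => j; rewrite /join_tuple /= (unsplitK (inl j)). Qed.

Lemma join_rshift X m (a b : 'I_m -> X) : join_tuple a b \o @rshift m m = b.
Proof. by apply/funext => j; rewrite /join_tuple /= (unsplitK (inr j)). Qed.

Section Implications.
Variables (L : signature) (T : theory L) (M : structure L).

Lemma satisfiable_range (I : Type) n m (phi : form L ('I_n + 'I_m)) (b : I -> 'I_m -> M) :
  satisfiable (range (fun i => inst phi (b i))) <->
  exists x, forall i, sat (copair x (b i)) phi.
Proof.
split=> -[x h]; exists x; first by move=> i; apply/sat_inst/h; exists i.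
by move=> _ [i _ <-]; apply/sat_inst.
Qed.

Lemma IP_OP : has_IP T M -> has_OP T M.
Proof.
move=> [n [m [phi [a [c [psi [neg h1 h0]]]]]]].
exists n, m, phi, a, (fun j => c (fun i => i < j)), psi; split=> // i j ij.
  exact: h1.
by apply: h0; rewrite ltnNge ij.
Qed.

Lemma SOP2_SOP1 : has_SOP2 T M -> has_SOP1 T M.
Proof.
move=> [n [m [phi [a [psi [neg path h]]]]]].
exists n, m, phi, a, psi; split=> // mu eta /prefixP [w ->]; apply: h.
have dif (b c : bool) s t : b != c -> ~~ prefix (rcons mu b ++ s) (rcons mu c ++ t).
  by move=> bc; rewrite !cat_rcons prefix_catr // prefix_cons (negbTE bc) andbF.
by rewrite /incomparable -[rcons mu true]cats0 !dif.
Qed.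

Lemma TP1_SOP2 : has_TP1 T M -> has_SOP2 T M.
Proof.
move=> [n [m [phi [a [psi [neg path h]]]]]].
pose c (s : seq bool) := map nat_of_bool s.
exists n, m, phi, (a \o c), psi; split=> [//|sigma|mu eta].
  have -> : (fun l => inst phi ((a \o c) (mkseq sigma l))) =
      fun l => inst phi (a (mkseq (nat_of_bool \o sigma) l)).
    by apply/funext => l; rewrite /= /c /mkseq -map_comp.
  exact: path.
have cp s t : prefix (c s) (c t) = prefix s t.
  by elim: s t => [|b s IH] [|b' t] //=; rewrite IH; case: b b' => -[].
by rewrite /incomparable -(cp mu) -(cp eta); apply: h.
Qed.

Lemma SOP2_TP1 : has_SOP2 T M -> has_TP1 T M.
Proof.
move=> [n [m [phi [a [psi [neg path h]]]]]].
exists n, m, phi, (a \o comb), psi; split=> [//|sigma|mu eta].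
  have [tau tauP] := comb_branch sigma; have /satisfiable_range[x xP] := path tau.
  by apply/satisfiable_range; exists x => l /=; rewrite tauP.
by move=> /andP[h1 h2]; apply: h; apply/andP; split; apply: contra (@prefix_comb _ _) _.
Qed.

Definition on_pair m (psi : form L ('I_m + 'I_m)) : form L ('I_2 * 'I_m) :=
  rename (copair (fun j => (ord0, j)) (fun j => (ord_max, j))) psi.

Lemma negation_pairs n m (phi : form L ('I_n + 'I_m)) (psi : form L ('I_m + 'I_m)) :
  negation T (ex_and2 phi) psi ->
  negation T (ex_andk 2 phi) (on_pair psi).
Proof.
move=> neg N NT [v [/sat_ex_andk [x h1] /sat_rename h2]]; apply: (neg N NT).
exists (copair (fun j => v (ord0, j)) (fun j => v (ord_max, j))); split.
  by apply/sat_ex_and2; exists x.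
by congr sat: h2; apply/funext => -[].
Qed.

Lemma SOP1_TP : has_SOP1 T M -> has_TP T M 2.
Proof.
move=> [n [m [phi [a [psi [neg path h]]]]]].
exists n, m, phi, (a \o comb), (on_pair psi); split; first exact: negation_pairs neg.
  move=> sigma.
  have [tau tauP] := comb_branch sigma; have /satisfiable_range[x xP] := path tau.
  by apply/satisfiable_range; exists x => l /=; rewrite tauP.
move=> eta i inc; apply/sat_rename; rewrite copair_comp /=.
have := comb_rcons eta (i ord0); rewrite /comp /= => ->.
by apply: h; apply: comb_sibling; apply: inc.
Qed.

Definition on_first_two k (hk : 2 <= k) m (psi : form L ('I_2 * 'I_m)) :
    form L ('I_k * 'I_m) :=
  rename (fun p => (widen_ord hk p.1, p.2)) psi.

Lemma negation_widen k n m (phi : form L ('I_n + 'I_m)) (psi : form L ('I_2 * 'I_m))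
    (hk : 2 <= k) :
  negation T (ex_andk 2 phi) psi ->
  negation T (ex_andk k phi) (on_first_two hk psi).
Proof.
move=> neg N NT [v [/sat_ex_andk [x h1] /sat_rename h2]]; apply: (neg N NT).
exists (fun p => v (widen_ord hk p.1, p.2)); split; last exact: h2.
by apply/sat_ex_andk; exists x => i; exact: (h1 (widen_ord hk i)).
Qed.

Lemma TP_two k : 2 <= k -> has_TP T M 2 -> has_TP T M k.
Proof.
move=> hk [n [m [phi [a [psi [neg path h]]]]]].
exists n, m, phi, a, (on_first_two hk psi); split; first exact: negation_widen neg.
  exact: path.
move=> eta i inc; apply/sat_rename.
by apply: (h eta (i \o widen_ord hk)) => p q pq; exact: inc.
Qed.

Lemma TP2_two k : 2 <= k -> has_TP2 T M 2 -> has_TP2 T M k.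
Proof.
move=> hk [n [m [phi [a [psi [neg path h]]]]]].
exists n, m, phi, a, (on_first_two hk psi); split; first exact: negation_widen neg.
  exact: path.
move=> i j inc; apply/sat_rename.
by apply: (h i (j \o widen_ord hk)) => p q pq; exact: inc.
Qed.

(** The nodes of length [l] use row [l], so that siblings receive distinct
    parameters of one row. *)
Lemma TP2_TP k : has_TP2 T M k -> has_TP T M k.
Proof.
move=> [n [m [phi [a [psi [neg path h]]]]]].
exists n, m, phi, (fun eta => a (size eta) (last 0 eta)), psi; split=> //.
  move=> sigma; pose tau i := if i is i'.+1 then sigma i' else 0.
  have /satisfiable_range[x xP] := path tau.
  apply/satisfiable_range; exists x => -[|l]; first exact: (xP 0).
  by rewrite size_mkseq mkseqS last_rcons; apply: (xP l.+1).
move=> eta i inc.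
have -> : (fun v : 'I_k * 'I_m =>
      a (size (rcons eta (i v.1))) (last 0 (rcons eta (i v.1))) v.2) = fun v => a (size eta).+1 (i v.1) v.2.
  by apply/funext => v; rewrite size_rcons last_rcons.
exact: h.
Qed.

(** Here [c sigma] realises the path [sigma] of the array.  In row [i] the
    parameters of columns 0 and 1 are inconsistent, so that satisfying the
    formula for column 0 is a negation of satisfying it for column 1, once the
    two parameters are recorded together. *)
Lemma TP2_IP : has_TP2 T M 2 -> has_IP T M.
Proof.
move=> [n [m [phi [a [psi [neg path h]]]]]].
have /choice [c cP] : forall sigma : nat -> bool, exists x, forall i,
    sat (copair x (a i (sigma i))) phi.
  by move=> sigma; apply/satisfiable_range/(path (nat_of_bool \o sigma)).
pose old : form L ('I_(m + m) + 'I_n) := rename (copair inr (inl \o @lshift m m)) phi.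
pose new : form L ('I_(m + m) + 'I_n) := rename (copair inr (inl \o @rshift m m)) phi.
pose side (p : 'I_2 * 'I_m) : 'I_(m + m) + 'I_n :=
  inl (if p.1 == ord0 then lshift m p.2 else rshift m p.2).
exists (m + m), n, new, (fun i => join_tuple (a i 0) (a i 1)), c,
  (FAnd old (rename side psi)); split.
- move=> N NT [v [/sat_rename h1 [/sat_rename h0 /sat_rename h2]]].
  apply: (neg N NT); exists (v \o side); split=> //; apply/sat_ex_andk.
  exists (v \o inr) => i; have [e|i0] := eqVneq i ord0.
    by congr sat: h0; apply/funext => -[] // j; rewrite /side /= e.
  by congr sat: h1; apply/funext => -[] // j; rewrite /side /= (negbTE i0).
- move=> i sigma si; apply/sat_rename; move: (cP sigma i); rewrite si.
  by rewrite copair_comp compA /= join_rshift.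
- move=> i sigma si; split.
    apply/sat_rename; move: (cP sigma i); rewrite si.
    by rewrite copair_comp compA /= join_lshift.
  apply/sat_rename; have := h i (fun p : 'I_2 => p) (fun p q => id).
  congr sat; apply/funext => -[p j]; rewrite /side /=.
  have [->|p0] := eqVneq p ord0.
    by rewrite -[RHS]/((join_tuple (a i 0) (a i 1) \o @lshift m m) j) join_lshift.
  have -> : p = ord_max by apply: val_inj; case: p p0 => -[|[|]].
  by rewrite -[RHS]/((join_tuple (a i 0) (a i 1) \o @rshift m m) j) join_rshift.
Qed.

End Implications.

(** * From SOP3 to SOP2: trees of intervals *)

(** A node of length [l] owns an interval of length [4 ^ (h + 1 - l)], whose
    second and third quarters go to its two children. *)
Fixpoint left_end (h : nat) (s : seq bool) : nat :=
  if s is b :: s' then (nat_of_bool b).+1 * 4 ^ h + left_end h.-1 s' else 0.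

Definition width (h : nat) (s : seq bool) : nat := 4 ^ (h.+1 - size s).

Lemma left_end_bound h s : size s <= h -> left_end h s + width h s <= 4 ^ h.+1.
Proof.
rewrite /width; elim: s h => [|b s IH] [|h] //= sh.
have := IH h sh; rewrite subSS !(expnS _ h.+1); case: b => /=; lia.
Qed.

Lemma left_end_cat h s t : left_end h (s ++ t) = left_end h s + left_end (h - size s) t.
Proof.
elim: s h => [|b s IH] h /=; first by rewrite subn0.
by rewrite IH addnA -subn1 -subnDA add1n.
Qed.

Lemma interval_nested h s t : size (s ++ t) <= h ->
  left_end h s <= left_end h (s ++ t) /\
  left_end h (s ++ t) + width h (s ++ t) <= left_end h s + width h s.
Proof.
rewrite left_end_cat leq_addr size_cat => st; split=> //.
have := @left_end_bound (h - size s) t; rewrite /width size_cat => /(_ ltac:(lia)).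
have -> : (h - size s).+1 - size t = h.+1 - (size s + size t) by lia.
have -> : (h - size s).+1 = h.+1 - size s by lia.
lia.
Qed.

Lemma interval_disjoint h s t : size s <= h -> size t <= h -> incomparable s t ->
  left_end h s + width h s <= left_end h t \/
  left_end h t + width h t <= left_end h s.
Proof.
elim: s h t => [|b s IH] [|h] [|c t] //=; rewrite ?prefix0s ?andbF //.
rewrite !ltnS => sh th; rewrite /incomparable !prefix_cons /width /= !subSS.
have := left_end_bound sh; have := left_end_bound th; rewrite /width.
have [<-|bc] := eqVneq b c; rewrite ?eqxx /=.
  by move=> _ _ inc; case: (IH h t sh th inc); rewrite /width; [left|right]; lia.
by case: b c bc => -[] //= _ h1 h2 _; [right|left]; lia.
Qed.

Section SOP3.
Variables (L : signature) (T : theory L) (K : Type) (M : structure L).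
Hypothesis hM : monster T K M.

(** The formula places a cut between the end points of an interval.  A cut just
    above the left end of the last interval of a branch lies in all intervals of
    this branch, while a cut inside two disjoint intervals contradicts [psi] at
    the right end of one and the left end of the other. *)
Lemma SOP3_SOP2 : has_SOP3 T M -> has_SOP2 T M.
Proof.
move=> [n [m [phi0 [phi1 [a [psi [neg cut h]]]]]]].
pose phi : form L ('I_n + 'I_(m + m)) :=
  FAnd (rename (copair inl (inr \o @lshift m m)) phi0)
       (rename (copair inl (inr \o @rshift m m)) phi1).
pose psi' : form L ('I_(m + m) + 'I_(m + m)) :=
  FOr (rename (copair (inl \o @rshift m m) (inr \o @lshift m m)) psi)
      (rename (copair (inr \o @rshift m m) (inl \o @lshift m m)) psi).
have phiE (N : structure L) (x : 'I_n -> N) (t : 'I_(m + m) -> N) :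
    sat (copair x t) phi <->
    sat (copair x (t \o @lshift m m)) phi0 /\ sat (copair x (t \o @rshift m m)) phi1.
  by rewrite /= !sat_rename !copair_comp.
have psiE (N : structure L) (t t' : 'I_(m + m) -> N) :
    sat (copair t t') psi' <->
    sat (copair (t \o @rshift m m) (t' \o @lshift m m)) psi \/
    sat (copair (t' \o @rshift m m) (t \o @lshift m m)) psi.
  by rewrite /= !sat_rename !copair_comp.
have neg' (N : structure L) (x : 'I_n -> N) (l r : 'I_m -> N) : models N T ->
    sat (copair x l) phi0 -> sat (copair x r) phi1 -> ~ sat (copair r l) psi.
  move=> NT h0 h1 hpsi; apply: (neg N NT); exists (copair r l); split=> //.
  by exists x; split; rewrite sat_rename copair_comp.
pose P (j : (nat -> bool) * nat + seq bool * seq bool)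
       (v : seq bool * 'I_(m + m) + (nat -> bool) * 'I_n -> M) : Prop :=
  match j with
  | inl (sigma, l) => sat (v \o copair (fun i => inr (sigma, i))
                               (fun i => inl (mkseq sigma l, i))) phi
  | inr (mu, eta) => incomparable mu eta ->
      sat (v \o copair (fun i => inl (mu, i)) (fun i => inl (eta, i))) psi'
  end.
pose supp (j : (nat -> bool) * nat + seq bool * seq bool) : seq nat :=
  match j with
  | inl (sigma, l) => [:: l]
  | inr (mu, eta) => [:: size mu; size eta]
  end.
have [||s|v vP] := saturation_stages hM (P := P) (supp := supp).
- have b := embeds_nat_form L.
  have bf : bounded (form L nat) (nat -> bool) by apply: bounded_fun; apply: bounded_count.
  apply: bounded_sum; apply: bounded_prod => //; exact: bounded_count.
- move=> [[sigma l]|[mu eta]]; first exact: definable_rename.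
  apply: definable_imp; exact: definable_rename.
- pose d := foldr maxn 0 s.
  have dP l : List.In l s -> l <= d.
    rewrite /d; elim: (s) => [//|p s' IH] /= [->|/IH h1]; first exact: leq_maxl.
    exact: leq_trans h1 (leq_maxr _ _).
  pose right_end eta := left_end d eta + (width d eta).-1.
  pose node eta := join_tuple (a (left_end d eta)) (a (right_end eta)).
  have wpos eta : 0 < width d eta by rewrite expn_gt0.
  have /choice [x xP] : forall sigma : nat -> bool, exists x, forall l, l <= d ->
      sat (copair x (node (mkseq sigma l))) phi.
    move=> sigma; have [x xP] := cut (left_end d (mkseq sigma d)).+1.
    exists x => l ld; apply/phiE; rewrite /node join_lshift join_rshift.
    have [t et] := prefix_mkseq sigma ld.
    have [|n1 n2] := @interval_nested d (mkseq sigma l) t; first by rewrite -et size_mkseq.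
    rewrite -et in n1 n2; split; apply/sat_inst/xP; [left|right].
      by exists (left_end d (mkseq sigma l)).
    exists (right_end (mkseq sigma l)) => //=; rewrite /right_end.
    move: n2; rewrite {1}/width size_mkseq subSn // subnn expn1.
    have := wpos (mkseq sigma l); lia.
  exists (fun z => match z with
    | inl (eta, i) => node eta i | inr (sigma, i) => x sigma i end).
  move=> [[sigma l]|[mu eta]] /= js; rewrite copair_comp.
    by apply: xP; apply: dP; apply: js; left.
  move=> inc.
  have mud : size mu <= d by apply: dP; apply: js; left.
  have etad : size eta <= d by apply: dP; apply: js; right; left.
  apply/psiE; rewrite /node !join_lshift !join_rshift.
  have := wpos eta; have := wpos mu.
  by case: (interval_disjoint mud etad inc) => dis w1 w2; [left|right]; apply: h;
    rewrite /right_end; lia.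
- exists n, (m + m), phi, (fun eta i => v (inl (eta, i))), psi'; split.
  + move=> N NT [t [ht hp]].
    have te : t = copair (t \o inl) (t \o inr) by apply/funext => -[].
    rewrite te in ht hp; move/psiE: hp => hp.
    have [x [/phiE[l0 l1] /phiE[r0 r1]]] := (sat_ex_and2 phi _ _).1 ht; case: hp => hp.
      exact: neg' NT r0 l1 hp.
    exact: neg' NT l0 r1 hp.
  + move=> sigma; apply/satisfiable_range; exists (fun i => v (inr (sigma, i))) => l.
    by have := vP (inl (sigma, l)); rewrite /P copair_comp.
  + by move=> mu eta inc; have := vP (inr (mu, eta)) inc; rewrite copair_comp.
Qed.

End SOP3.

(** * Extendable sets of parameters *)

Lemma In_pmap (Z X : Type) (f : Z -> option X) (s : seq Z) z x :
  List.In z s -> f z = Some x -> List.In x (pmap f s).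
Proof.
elim: s => [//|y s IH] /= [->|h] e; first by rewrite e; left.
by case: (f y) => [w|] /=; [right|]; apply: IH.
Qed.

Lemma In_map (Z X : Type) (f : Z -> X) (s : seq Z) x :
  List.In x (map f s) <-> exists2 z, List.In z s & f z = x.
Proof.
elim: s => [|y s IH] /=; first by split=> // -[].
rewrite IH; split=> [[<-|[z zs <-]]|[z [->|zs] e]].
- by exists y; [left|].
- by exists z; [right|].
- by left.
- by right; exists z.
Qed.

Lemma In_enum (T : finType) (x : T) : List.In x (enum T).
Proof. by apply/In_mem; rewrite mem_enum. Qed.

Definition siblings k (i : 'I_k -> seq nat) : Prop :=
  exists eta j, increasing j /\ forall p, i p = rcons eta (j p).

Lemma siblings_cons k (i : 'I_k -> seq nat) c : siblings i -> siblings (fun p => c :: i p).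
Proof. by move=> [eta [j [inc e]]]; exists (c :: eta), j; split=> // p; rewrite e. Qed.

Section Trees.
Variables (L : signature) (M : structure L) (k : nat) (X Y : Type).
Variables (phi : form L (X + Y)) (psi : form L ('I_k * Y)).

(** The restriction to the nodes in [s] of a tree over the parameters in [B]:
    [y] gives the parameters at the nodes and [x] the realisations of the
    branches, as functions on all nodes so that no type depends on [s]. *)
Definition finite_tree (s : seq (seq nat)) (B : seq (Y -> M)) : Prop :=
  exists (y : seq nat -> Y -> M) (x : seq nat -> X -> M),
  [/\ forall sigma eta, sigma \in s -> eta \in s -> prefix eta sigma ->
        sat (copair (x sigma) (y eta)) phi,
      forall sigma b, sigma \in s -> List.In b B -> sat (copair (x sigma) b) phi &
      forall i : 'I_k -> seq nat, siblings i -> (forall p, i p \in s) ->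
        sat (fun v => y (i v.1) v.2) psi].

(** Asking only for finite pieces gives a property of finite character, which
    passes to unions of chains; infinite trees come back through saturation when
    [A] has bounded size. *)
Definition extendable (A : set (Y -> M)) : Prop :=
  forall s B, (forall b, List.In b B -> A b) -> finite_tree s B.

Lemma extendable_sub A B : A `<=` B -> extendable B -> extendable A.
Proof. by move=> AB h s C CA; apply: h => b /CA /AB. Qed.

End Trees.

Section Widen.
Variables (L : signature) (T : theory L) (K : Type) (M : structure L).
Hypothesis hM : monster T K M.
Variables (k : nat) (X Y : Type).
Variables (phi : form L (X + Y)) (psi : form L ('I_k * Y)).

Local Notation F := (form L nat).
Local Notation extendable := (@extendable L M k X Y phi psi).

(** Finitely many of the [b n] are found among the children of the root of a
    finite tree over [A], and the subtree above such a child shows that it can be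
    added to [A].  Inconsistency of siblings is only known for increasing
    indices, whence the order on [N]. *)
Lemma widen (A : set (Y -> M)) (D : Type) (g : D -> Y -> M)
    (N : Type) (lt : N -> N -> Prop) :
  bounded F D -> A `<=` range g -> bounded F N -> strict_wo lt -> extendable A ->
  exists b : N -> Y -> M,
    (forall i : 'I_k -> N, (forall p q : 'I_k, p < q -> lt (i p) (i q)) ->
       sat (fun v => b (i v.1) v.2) psi) /\
    forall n, extendable (A `|` [set b n]).
Proof.
move=> bD Ag bN wo extA; have Fnat := embeds_nat_form L.
pose J : Type :=
  ((N * seq nat * seq nat) + (N * seq nat * D)) + ((N * ('I_k -> seq nat)) + ('I_k -> N)).
pose P (j : J) (v : N * seq nat * Y + N * seq nat * X -> M) : Prop :=
  match j with
  | inl (inl (n, sigma, eta)) => prefix eta sigma ->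
      sat (v \o copair (fun i => inr (n, sigma, i)) (fun i => inl (n, eta, i))) phi
  | inl (inr (n, sigma, d)) => A (g d) ->
      sat (copair v id \o copair (fun i => inl (inr (n, sigma, i))) (fun i => inr (g d i))) phi
  | inr (inl (n, i)) => siblings i ->
      sat (v \o (fun p => inl (n, i p.1, p.2))) psi
  | inr (inr i) => (forall p q : 'I_k, p < q -> lt (i p) (i q)) ->
      sat (v \o (fun p => inl (i p.1, [::], p.2))) psi
  end.
pose supp (j : J) : seq (N + (seq nat + D)) :=
  match j with
  | inl (inl (n, sigma, eta)) => [:: inl n; inr (inl sigma); inr (inl eta)]
  | inl (inr (n, sigma, d)) => [:: inl n; inr (inl sigma); inr (inr d)]
  | inr (inl (n, i)) => inl n :: [seq inr (inl (i p)) | p <- enum 'I_k]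
  | inr (inr i) => [seq inl (i p) | p <- enum 'I_k]
  end.
have [||zs|v vP] := saturation_stages hM (P := P) (supp := supp).
- have bs : bounded F (seq nat) by apply: bounded_count.
  have bk : bounded F 'I_k by apply: bounded_count.
  by do ?[exact: bs|exact: bk|exact: bD|exact: bN|apply: bounded_sum
         |apply: bounded_prod|apply: bounded_fun].
- case=> [[[[n sigma] eta]|[[n sigma] d]]|[[n i]|i]]; apply: definable_imp.
  + exact: definable_rename.
  + exact: definable_sat.
  + exact: definable_rename.
  + exact: definable_rename.
- pose ns := pmap (fun z : N + (seq nat + D) => if z is inl n then Some n else None) zs.
  pose es := pmap (fun z : N + (seq nat + D) =>
    if z is inr (inl eta) then Some eta else None) zs.
  pose ds := pmap (fun z : N + (seq nat + D) =>
    if z is inr (inr d) then Some d else None) zs.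
  have nsP n : List.In (inl n) zs -> List.In n ns by move=> h; apply: In_pmap h _.
  have esP eta : List.In (inr (inl eta)) zs -> List.In eta es.
    by move=> h; apply: In_pmap h _.
  have dsP d : List.In (inr (inr d)) zs -> List.In d ds by move=> h; apply: In_pmap h _.
  (* The position of [n] among the indices mentioned: [b n] is placed at this
     child of the root. *)
  pose code n := count (fun n' => `[< lt n' n >]) ns.
  have code_lt n n' : lt n n' -> List.In n ns -> code n < code n'.
    move=> nn'; have le s : count (fun n0 => `[< lt n0 n >]) s <=
        count (fun n0 => `[< lt n0 n' >]) s.
      apply: sub_count => m /asboolP mn; apply/asboolP.
      by case: wo => _ tr _; apply: tr nn'.
    rewrite /code; elim: (ns) => [//|m s IH] /= [->|/IH h].
      rewrite (asboolT nn') asboolF ?add0n ?add1n ?ltnS //.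
      by move=> nn; case: (strict_wo_irr wo nn).
    have := le [:: m]; rewrite /= !addn0 -addnS => le1; exact: leq_add.
  pose tr := [seq c :: eta | c <- map code ns, eta <- [::] :: es].
  have trP n eta : List.In n ns -> eta = [::] \/ List.In eta es -> code n :: eta \in tr.
    move=> nn ee; apply/allpairsP; exists (code n, eta); split=> //=.
      by apply/In_mem/In_map; exists n.
    by rewrite inE; case: ee => [->//|/In_mem ->]; rewrite orbT.
  have [|y [x [h1 h2 h3]]] := extA tr [seq g d | d <- ds & `[< A (g d) >]].
    move=> b /In_map[d dd <-]; elim: (ds) dd => [//|e s IH] /=.
    by case: asboolP => // Ae; case=> [<-//|].
  exists (fun z => match z with
    | inl (n, eta, i) => y (code n :: eta) i
    | inr (n, sigma, i) => x (code n :: sigma) i end).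
  case=> [[[[n sigma] eta]|[[n sigma] d]]|[[n i]|i]] /= js.
  + move=> es'; rewrite copair_comp; apply: h1.
    * by apply: trP; [apply/nsP/js; left|right; apply/esP/js; right; left].
    * by apply: trP; [apply/nsP/js; left|right; apply/esP/js; right; right; left].
    * by rewrite prefix_cons eqxx.
  + move=> Ad; rewrite copair_comp; apply: h2.
      by apply: trP; [apply/nsP/js; left|right; apply/esP/js; right; left].
    apply/In_map; exists d => //.
    have : List.In d ds by apply/dsP/js; right; right; left.
    by elim: (ds) => [//|e s IH] /= [->|/IH h]; case: asboolP => //; [left|right].
  + move=> sib; apply: (h3 (fun p => code n :: i p)); first exact: siblings_cons.
    move=> p; apply: trP; [apply/nsP/js; left=> //|right; apply/esP/js; right].
    by apply/In_map; exists p => //; apply: In_enum.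
  + move=> inc; apply: (h3 (fun p => [:: code (i p)])).
      exists [::], (fun p => code (i p)); split=> // p q pq; apply: code_lt; first exact: inc.
      by apply/nsP/js/In_map; exists p => //; apply: In_enum.
    move=> p; apply: trP; last by left.
    by apply/nsP/js/In_map; exists p => //; apply: In_enum.
- exists (fun n i => v (inl (n, [::], i))); split.
    by move=> i; apply: (vP (inr (inr i))).
  move=> n s B BA.
  exists (fun eta i => v (inl (n, 0 :: eta, i))), (fun sigma i => v (inr (n, 0 :: sigma, i))).
  split=> [sigma eta _ _ es|sigma b _ bB|i sib _].
  + have := vP (inl (inl (n, 0 :: sigma, 0 :: eta))); rewrite /P copair_comp; apply.
    by rewrite prefix_cons eqxx.
  + case: (BA b bB) => [Ab|->].
      have [d _ e] := Ag b Ab; have := vP (inl (inr (n, 0 :: sigma, d))).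
      by rewrite /P copair_comp /= -e; apply; rewrite e.
    by have := vP (inl (inl (n, 0 :: sigma, [::]))); rewrite /P copair_comp; apply.
  + exact: (vP (inr (inl (n, fun p => 0 :: i p)))) (siblings_cons 0 sib).
Qed.

End Widen.

(** * From 2-TP to OP *)

(** The colours used in the partition theorem are formulas with variables in
    [nat], whose size is under control; a formula with variables in another
    countable type can be recovered up to equivalence from its renaming. *)
Lemma sat_coded (L : signature) (M : structure L) (V : countType) (p q : form L V)
    (v : V -> M) :
  rename pickle p = rename pickle q -> sat v p -> sat v q.
Proof.
move=> e vp; pose w z := if @unpickle V z is Some x then v x else structure_point M.
have wE : w \o pickle = v by apply/funext => x; rewrite /w /= pickleK.
by rewrite -wE -sat_rename -e sat_rename wE.
Qed.

Lemma negation_sym (L : signature) (T : theory L) V (p q : form L V) :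
  negation T p q -> negation T q p.
Proof. by move=> neg N NT [v [h1 h2]]; apply: (neg N NT); exists v. Qed.

Section TPOP.
Variables (L : signature) (T : theory L) (K : Type) (M : structure L).
Hypothesis hM : monster T K M.

Local Notation F := (form L nat).

(** A finite sequence is continued by zeros to name a branch through it. *)
Lemma tree_extendable k n m (phi : form L ('I_n + 'I_m)) (psi : form L ('I_k * 'I_m))
    (a : seq nat -> 'I_m -> M) :
  (forall sigma, satisfiable (range (fun l => inst phi (a (mkseq sigma l))))) ->
  (forall (eta : seq nat) (i : 'I_k -> nat), increasing i ->
     sat (fun v => a (rcons eta (i v.1)) v.2) psi) ->
  extendable (M := M) phi psi set0.
Proof.
move=> path sib s B B0.
have /choice [x xP] : forall sigma : nat -> nat, exists x, forall l,
    sat (copair x (a (mkseq sigma l))) phi by move=> sigma; apply/satisfiable_range/path.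
exists a, (fun sigma => x (nth 0 sigma)); split.
- move=> sigma eta _ _ /prefixP [w ->].
  have {2}-> : eta = mkseq (nth 0 (eta ++ w)) (size eta); last exact: xP.
  apply: (@eq_from_nth _ 0); first by rewrite size_mkseq.
  by move=> i il; rewrite nth_mkseq // nth_cat il.
- by move=> sigma b _ /B0.
- move=> i [eta [j [inc e]]] _; have := sib eta j inc.
  by congr sat; apply/funext => v; rewrite e.
Qed.

Lemma extendable_realized k (X Y : Type) (phi : form L (X + Y)) (psi : form L ('I_k * Y))
    (A : set (Y -> M)) (D : Type) (g : D -> Y -> M) :
  bounded F D -> A `<=` range g -> extendable phi psi A ->
  exists x : X -> M, forall a, A a -> sat (copair x a) phi.
Proof.
move=> bD Ag ext.
have [||s|x xP] := @saturation L T K M hM X D (fun d x => A (g d) -> sat (copair x (g d)) phi).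
- exact: bD.
- move=> d; apply: definable_imp; have [th thP] := definable_sat (copair inl (inr \o g d)) phi.
  by exists th => v; rewrite -thP copair_comp.
- have [|y [x [_ h _]]] := ext [:: [::]] [seq g d | d <- s & `[< A (g d) >]].
    move=> b /In_map[d dd <-]; elim: (s) dd => [//|e s' IH] /=.
    by case: asboolP => // Ae; case=> [<-//|].
  exists (x [::]) => d ds Ad; apply: h => //; apply/In_map; exists d => //.
  by elim: (s) ds => [//|e s' IH] /= [->|/IH h']; case: asboolP => //; [left|right].
- by exists x => a Aa; have [d _ e] := Ag a Aa; rewrite -e; apply: xP; rewrite e.
Qed.

(** The parameters [a_i] and the realisations [c_i] are the components of
    [h i].  The negation obtained at the end has OP, with [phi] as its own
    negation: it holds of [(c_i, a_j)] for [i < j], and [phi] for [i >= j]. *)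
Lemma TP_OP : has_TP T M 2 -> has_OP T M.
Proof.
move=> [n [m [phi [a0 [psi [neg path sib]]]]]].
have ext0 := tree_extendable path sib.
have Fnat := embeds_nat_form L.
have [W [lt [bW wo ER]]] := erdos_rado_type Fnat (@bounded_base F).
have [lt' wo'] := well_ordering (set W).
have [wf tr tot] := wo.
pose Q : Type := ('I_m -> M) * ('I_n -> M).
pose G (S : set Q) (q : Q) : Prop :=
  [/\ extendable phi psi (fst @` S `|` [set q.1]),
      forall p, S p -> ~ sat (copair p.2 q.1) phi,
      sat (copair q.2 q.1) phi & forall p, S p -> sat (copair q.2 p.1) phi].
have Gex (S : set Q) (h : W -> Q) : S `<=` range h ->
    extendable phi psi (fst @` S) -> exists q, G S q.
  move=> Sh ext; have Ag : fst @` S `<=` range (fst \o h).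
    by move=> _ [p /Sh [w _ <-] <-]; exists w.
  have [b [bsib bext]] := widen hM bW Ag (bounded_set bW) wo' ext.
  have [nn avoid] : exists N, forall p, S p -> ~ sat (copair p.2 (b N)) phi.
    apply: contrapT => none.
    have /choice [f fP] : forall N, exists w, sat (copair (h w).2 (b N)) phi.
      move=> N; apply: contrapT => hN; apply: none; exists N => p Sp sp.
      by apply: hN; have [w _ e] := Sh p Sp; exists w; rewrite e.
    (* One realisation satisfies the formula for at most one candidate, and
       there are more candidates than earlier stages. *)
    apply: (@Cantor W); exists f.
    have key N N' : f N = f N' -> ~ lt' N N'.
      move=> e NN'; have [_ [MT _] _ _] := hM; apply: (neg M MT).
      exists (fun v => b (if v.1 == ord0 then N else N') v.2); split.
        apply/sat_ex_andk; exists (h (f N)).2 => i /=; case: ifP => _; first exact: fP.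
        by rewrite e.
      have := bsib (fun p : 'I_2 => if p == ord0 then N else N'); apply.
      by move=> [[|[|p]] hp] [[|[|q]] hq].
    move=> N N' e; case: wo' => _ _ /(_ N N') [h1|//|h1].
      by case: (key _ _ e).
    by case: (key _ _ (esym e)).
  have Ag' : fst @` S `|` [set b nn] `<=` range (copair (fst \o h) (fun _ : unit => b nn)).
    move=> _ [/Ag[w _ <-]|->]; first by exists (inl w).
    by exists (inr tt).
  have [|c cP] := extendable_realized _ Ag' (bext nn).
    by apply: bounded_sum => //; apply: bounded_count.
  exists (b nn, c); split=> //=; first by apply: cP; right.
  by move=> p Sp; apply: cP; left; exists p.
have /choice [step stepP] : forall S : set Q, exists q, (exists q, G S q) -> G S q.
  move=> S; have [[q Gq]|no] := EM (exists q, G S q); first by exists q.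
  by exists (fun=> structure_point M, fun=> structure_point M).
pose rec_step (i : W) (rec : forall j, lt j i -> Q) :=
  step [set q | exists j (lj : lt j i), q = rec j lj].
pose h := Fix wf (fun=> Q) rec_step.
have hE i : h i = step [set h j | j in [set j | lt j i]].
  rewrite {1}/h Fix_eq; last first.
    move=> x g1 g2 e; suff -> : g1 = g2 by [].
    apply: functional_extensionality_dep => j.
    by apply: functional_extensionality_dep => lj; apply: e.
  rewrite /rec_step; congr step; apply/seteqP.
  by split=> q; [case=> j [lj ->]; exists j|case=> j lj <-; exists j, lj].
have hG i : G [set h j | j in [set j | lt j i]] (h i).
  elim/(well_founded_ind wf): i => i IH; rewrite hE; apply: stepP.
  apply: (Gex _ h); first by move=> _ [j _ <-]; exists j.
  move=> s B BA.
  (* The last of the finitely many stages that occur in [B] takes care of all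
     of them, also when [i] is a limit. *)
  have [->|[j [lj jB]]] : B = [::] \/ exists j, lt j i /\ forall b, List.In b B ->
      (fst @` [set h j' | j' in [set j' | lt j' j]] `|` [set (h j).1]) b.
  - elim: B BA => [|b B IHB] BA; [by left|right].
    have [_ [j0 lj0 <-] e0] := BA b (or_introl erefl).
    have [|e|[j [lj jB]]] := IHB; first by move=> b' hb; apply: BA; right.
      by exists j0; split=> // b' [<-|]; [right|rewrite e].
    have [j0j|e1|jj0] := tot j0 j.
    + exists j; split=> // b' [<-|/jB //]; left; exists (h j0) => //; by exists j0.
    + by exists j; split=> // b' [<-|/jB //]; right; rewrite -e1.
    + exists j0; split=> // b' [<-|/jB]; first by right.
      case=> [[_ [j1 l1 <-] <-]|->]; left.
        by exists (h j1) => //; exists j1 => //; apply: tr l1 jj0.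
      by exists (h j) => //; exists j.
  - by apply: ext0.
  - by have [ext _ _ _] := IH j lj; apply: ext.
have hlt j i : lt j i -> [/\ ~ sat (copair (h j).2 (h i).1) phi &
    sat (copair (h i).2 (h j).1) phi].
  move=> ji; have [_ h1 _ h2] := hG i.
  by split; [apply: h1|apply: h2]; exists j.
have hrefl i : sat (copair (h i).2 (h i).1) phi by have [] := hG i.
have /choice [f fP] : forall ji : W * W, exists c : F, lt ji.1 ji.2 ->
    exists rho, [/\ negation T phi rho, rename pickle rho = c &
      sat (copair (h ji.1).2 (h ji.2).1) rho].
  move=> [j i] /=; have [ji|nji] := EM (lt j i); last by exists FTop.
  have [/(ec_negation hM) [rho [nrho srho]] _] := hlt j i ji.
  by exists (rename pickle rho) => _; exists rho.
have [chi [u uP]] := ER (fun j i => f (j, i)).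
have [rho0 [neg0 e0 _]] := fP (u 0, u 1) (uP 0 1 isT).1.
rewrite (uP 0 1 isT).2 in e0.
exists n, m, rho0, (fun i => (h (u i)).2), (fun j => (h (u j)).1), phi; split.
- exact: negation_sym.
- move=> i j ij; have [lij cij] := uP i j ij.
  have [rho [_ e srho]] := fP (u i, u j) lij.
  by apply: sat_coded srho; rewrite e cij.
- move=> i j; rewrite leq_eqVlt => /orP[/eqP->|ji]; first exact: hrefl.
  by have [_] := hlt _ _ (uP j i ji).1.
Qed.

End TPOP.

(** * From an extendable set to a tree *)

(** The formula [ex_andk] with object variables in a finite type; the
    variables of the formulas that speak about trees are nodes and pairs of
    indices. *)
Definition ex_andk_fin (L : signature) k (X : finType) (Y : Type) (th : form L (X + Y)) :
    form L ('I_k * Y) :=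
  FEx #|X| (\big[FAnd/FTop]_(i < k)
    rename (copair (inl \o enum_rank) (fun j => inr (i, j))) th).

Lemma sat_ex_andk_fin (L : signature) (M : structure L) k (X : finType) (Y : Type)
    (th : form L (X + Y)) (t : 'I_k * Y -> M) :
  sat t (ex_andk_fin k th) <->
  exists x : X -> M, forall i, sat (copair x (fun j => t (i, j))) th.
Proof.
have e (x : 'I_#|X| -> M) (i : 'I_k) :
    sat (copair x t) (rename (copair (inl \o enum_rank) (fun j => inr (i, j))) th) <->
    sat (copair (x \o enum_rank) (fun j => t (i, j))) th.
  by rewrite sat_rename copair_comp.
rewrite /=; split=> -[x h].
  by exists (x \o enum_rank) => i; apply/e; move: h; rewrite sat_bigfin; apply.
exists (x \o enum_val); rewrite sat_bigfin => i _; apply/e.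
have -> : (x \o enum_val) \o enum_rank = x by apply/funext => z /=; rewrite enum_rankK.
exact: h.
Qed.

Section KTP.
Variables (L : signature) (T : theory L) (K : Type) (M : structure L).
Hypothesis hM : monster T K M.

Local Notation F := (form L nat).

(** By saturation with one tuple of variables for each branch
    [sigma : nat -> nat].  When finitely many nodes are considered, a branch is
    realised by what realises its longest initial segment among them. *)
Lemma extendable_TP k (X Y : finType) (th : form L (X + Y)) (rho : form L ('I_k * Y)) :
  negation T (ex_andk_fin k th) rho -> extendable (M := M) th rho set0 -> has_TP T M k.
Proof.
move=> neg ext; have Fnat := embeds_nat_form L.
pose P (j : (nat -> nat) * nat + ('I_k -> seq nat))
       (v : seq nat * Y + (nat -> nat) * X -> M) : Prop :=
  match j with
  | inl (sigma, l) => sat (v \o copair (fun i => inr (sigma, i))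
                               (fun i => inl (mkseq sigma l, i))) th
  | inr i => siblings i -> sat (v \o (fun p => inl (i p.1, p.2))) rho
  end.
pose supp (j : (nat -> nat) * nat + ('I_k -> seq nat)) : seq (seq nat) :=
  match j with
  | inl (sigma, l) => [:: mkseq sigma l]
  | inr i => [seq i p | p <- enum 'I_k]
  end.
have [||s|v vP] := saturation_stages hM (P := P) (supp := supp).
- have bn : bounded F nat by apply: bounded_count.
  have bs : bounded F (seq nat) by apply: bounded_count.
  have bk : bounded F 'I_k by apply: bounded_count.
  by do ?[exact: bs|exact: bk|exact: bn|apply: bounded_sum
         |apply: bounded_prod|apply: bounded_fun].
- move=> [[sigma l]|i]; first exact: definable_rename.
  apply: definable_imp; exact: definable_rename.
- have [//|y [x [h1 _ h3]]] := ext s [::].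
  have /choice [z zP] : forall sigma : nat -> nat, exists z, forall l,
      mkseq sigma l \in s -> sat (copair z (y (mkseq sigma l))) th.
    move=> sigma; pose p l := mkseq sigma l \in s.
    have [[l0 pl0]|none] := EM (exists l, p l); last first.
      by exists (x [::]) => l ls; case: none; exists l.
    have pb l : p l -> l <= foldr maxn 0 (map size s).
      rewrite /p -{2}(size_mkseq sigma l); elim: (s) => [//|t s' IH].
      rewrite inE => /orP[/eqP-> /=|/IH h /=]; first exact: leq_maxl.
      exact: leq_trans h (leq_maxr _ _).
    case: (@ex_maxnP p _ (ex_intro _ l0 pl0) pb) => d pd dmax.
    exists (x (mkseq sigma d)) => l ls; apply: h1 => //.
    by have [w ->] := prefix_mkseq sigma (dmax l ls); apply: prefix_prefix.
  exists (fun u => match u with inl (eta, i) => y eta i | inr (sigma, i) => z sigma i end).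
  move=> [[sigma l]|i] /= js.
    by rewrite copair_comp; apply: zP; apply/In_mem/js; left.
  move=> sib; apply: (h3 i) => // p; apply/In_mem/js/In_map.
  by exists p => //; apply: In_enum.
- pose phi : form L ('I_#|X| + 'I_#|Y|) :=
    rename (copair (inl \o enum_rank) (inr \o enum_rank)) th.
  pose psi : form L ('I_k * 'I_#|Y|) := rename (fun p => (p.1, enum_rank p.2)) rho.
  pose a eta (i : 'I_#|Y|) := v (inl (eta, enum_val i)).
  exists #|X|, #|Y|, phi, a, psi; split.
  + move=> N NT [t [/sat_ex_andk [x h1] /sat_rename h2]]; apply: (neg N NT).
    exists (t \o (fun p => (p.1, enum_rank p.2))); split=> //.
    apply/sat_ex_andk_fin; exists (x \o enum_rank) => i.
    by move: (h1 i) => /sat_rename; rewrite copair_comp.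
  + move=> sigma; apply/satisfiable_range; exists (fun i => v (inr (sigma, enum_val i))) => l.
    apply/sat_rename; have := vP (inl (sigma, l)); rewrite /P.
    by congr sat; apply/funext => -[i|i] /=; rewrite /a enum_rankK.
  + move=> eta i inc; apply/sat_rename.
    have := vP (inr (fun p => rcons eta (i p))); rewrite /P.
    have -> : v \o (fun p : 'I_k * Y => inl (rcons eta (i p.1), p.2)) =
      (fun u => a (rcons eta (i u.1)) u.2) \o (fun p => (p.1, enum_rank p.2)).
      by apply/funext => p /=; rewrite /a enum_rankK.
    by apply; exists eta, i.
Qed.

End KTP.

(** * Splitting patterns *)

Section Splitting.
Variables (Y : Type) (c0 : Y) (ext : set Y -> Prop).
Hypothesis ext_sub : forall A B, A `<=` B -> ext B -> ext A.

Section Pattern.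
Variables (kappa r : nat) (rel : ('I_kappa -> 'I_r -> Y) -> Prop).

(** A rank on extendable sets: [n] is the height of a tree of [r]-tuples all of
    whose paths can be added to [A], and [rel] says that the tuples at siblings
    are inconsistent. *)
Fixpoint splits (n : nat) (A : set Y) : Prop :=
  if n is n'.+1 then
    exists t : nat -> 'I_r -> Y,
      (forall i, increasing i -> rel (t \o i)) /\
      forall l, splits n' (A `|` range (t l))
  else ext A.

Lemma splits_sub n A B : A `<=` B -> splits n B -> splits n A.
Proof.
elim: n A B => [|n IH] A B AB /=; first exact: ext_sub.
by move=> [t [trel h]]; exists t; split=> // l; apply: IH (h l); apply: setSU.
Qed.

Lemma splits_ext n A : splits n A -> ext A.
Proof.
elim: n A => [//|n IH] A /= [t [_ /(_ 0) /IH]]; apply: ext_sub; exact: subsetUl.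
Qed.

Definition path_entries (y : seq nat -> 'I_r -> Y) (sigma : seq nat) : set Y :=
  [set c | exists eta p, [/\ 0 < size eta, prefix eta sigma & c = y eta p]].

(** The root carries no tuple: the value of [y] there is a default. *)
Lemma splits_tree n A : splits n A -> exists y : seq nat -> 'I_r -> Y,
  (forall sigma, size sigma <= n -> ext (A `|` path_entries y sigma)) /\
  forall eta i, size eta < n -> increasing i -> rel (fun p => y (rcons eta (i p))).
Proof.
elim: n A => [|n IH] A.
  move=> eA; exists (fun _ _ => c0); split=> // sigma; rewrite leqn0 size_eq0 => /eqP ->.
  apply: ext_sub eA => x [//|[eta [p [e0 + _]]]].
  by rewrite prefixs0 => /eqP e; rewrite e in e0.
move=> sp; have eA := splits_ext sp; case: sp => t [trel /= h].
have /choice [y yP] := fun l => IH _ (h l).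
exists (fun eta => if eta is l :: eta' then if eta' is [::] then t l else y l eta' else t 0).
split=> [[|l sigma] sn|[|l eta] i en inc].
- apply: ext_sub eA => x [//|[eta [p [e0 + _]]]].
  by rewrite prefixs0 => /eqP e; rewrite e in e0.
- apply: ext_sub (proj1 (yP l) sigma sn) => x [Ax|[[|l' [|c eta]] [p [//= _]]]].
  + by left; left.
  + by rewrite prefix0s andbT => /eqP -> ->; left; right; exists p.
  + by move=> /andP[/eqP -> pe] ->; right; exists (c :: eta), p.
- exact: trel.
- have := proj2 (yP l) eta i en inc; congr rel; apply/funext => p /=.
  by case: (eta) => [|c s].
Qed.

End Pattern.

(** Zorn's lemma is applied to partial functions on the pairs [(e, n)] whose
    values are finite lists such that [Sp e n] fails over the union of all the
    lists.  If some list shows that the union for a maximal function is not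
    stable, the function can be enlarged by it.  Having one list for each pair
    keeps the union bounded. *)
Lemma stable_set (F E : Type) (Sp : E -> nat -> set Y -> Prop) :
  embeds nat F -> bounded F E ->
  (forall e n A B, A `<=` B -> Sp e n B -> Sp e n A) ->
  (forall A, (forall s, (forall c, List.In c s -> A c) -> ext [set c | List.In c s]) ->
     ext A) ->
  ext set0 ->
  exists A, [/\ exists (D : Type) (g : D -> Y), bounded F D /\ A `<=` range g, ext A &
    forall e n l, ext (A `|` [set c | List.In c l]) -> Sp e n A ->
      Sp e n (A `|` [set c | List.In c l])].
Proof.
move=> Fnat bE Spsub extfin ext0; pose Q : Type := (E * nat) * seq Y.
pose supp (G : set Q) : set Y := [set c | exists q l, G (q, l) /\ List.In c l].
have suppS G G' : G `<=` G' -> supp G `<=` supp G'.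
  by move=> GG c [q [l [Gq cl]]]; exists q, l; split=> //; apply: GG.
pose P (G : set Q) := [/\ forall q l l', G (q, l) -> G (q, l') -> l = l',
  ext (supp G) & forall e n l, G (e, n, l) -> ~ Sp e n (supp G)].
have [ch chP chT|G [[Gfun Gext GSp] Gmax]] := @Zorn_bigcup Q P.
  split.
  - move=> q l l' [G1 ch1 G1q] [G2 ch2 G2q]; have [s12|s21] := chT _ _ ch1 ch2.
      by have [h _ _] := chP _ ch2; apply: (h q) => //; apply: s12.
    by have [h _ _] := chP _ ch1; apply: (h q) => //; apply: s21.
  - apply: extfin => s sP.
    have [->|[G [chG sG]]] : s = [::] \/ exists G, ch G /\ forall c, List.In c s -> supp G c.
    + elim: s sP => [|c s IH] sP; [by left|right].
      have [q [l [[G1 ch1 G1q] cl]]] := sP c (or_introl erefl).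
      have [|e|[G2 [ch2 sG2]]] := IH; first by move=> d ds; apply: sP; right.
        by exists G1; split=> // d [<-|]; [exists q, l|rewrite e].
      have [s12|s21] := chT _ _ ch1 ch2.
        by exists G2; split=> // d [<-|/sG2 //]; exists q, l; split=> //; apply: s12.
      by exists G1; split=> // d [<-|/sG2 /(suppS _ _ s21) //]; exists q, l.
    + by apply: ext_sub ext0 => c [].
    + by have [_ h _] := chP G chG; apply: ext_sub h.
  - move=> e n l [G chG Gq] /Spsub h; have [_ _ hG] := chP G chG.
    by apply: (hG e n l Gq); apply: h; apply: suppS => x Gx; exists G.
exists (supp G); split=> //.
  have /choice [g gP] : forall qi : (E * nat) * nat, exists c, forall l, G (qi.1, l) ->
      c = nth c0 l qi.2.
    move=> [q i] /=; have [[l Gl]|no] := EM (exists l, G (q, l)).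
      by exists (nth c0 l i) => l' Gl'; rewrite (Gfun _ _ _ Gl Gl').
    by exists c0 => l Gl; case: no; exists l.
  exists (E * nat * nat)%type, g; split.
    by do ?[exact: bE|exact: bounded_nat|apply: bounded_prod].
  move=> c [q [l [Gq cl]]].
  have [i e] : exists i, nth c0 l i = c.
    elim: l cl {Gq} => [//|d l IH] /= [->|/IH [i e]]; [by exists 0|by exists i.+1].
  by exists (q, i) => //; rewrite (gP (q, i) l Gq).
move=> e n l extl SpA; apply: contrapT => nSp.
pose G' := G `|` [set (e, n, l)].
have suppG' : supp G' = supp G `|` [set c | List.In c l].
  apply/seteqP; split=> c.
    case=> q [l' [[Gq|[_ ->]] cl]]; [by left; exists q, l'|by right].
  case=> [[q [l' [Gq cl]]]|cl]; first by exists q, l'; split=> //; left.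
  by exists (e, n), l; split=> //; right.
have nG l' : ~ G (e, n, l') by move=> /GSp.
apply: (Gmax G').
  split; first by move=> x Gx; left.
  by move=> h; apply: (nG l); apply: h; right.
split; rewrite ?suppG' //.
- move=> q l1 l2 [G1|[e1 ->]] [G2|[e2 ->]] //; first exact: Gfun G1 G2.
    by case: (nG l1); rewrite -e2.
  by case: (nG l2); rewrite -e1.
- move=> e' n' l' [Gq|[-> -> _]] //.
  by move=> /Spsub h; apply: (GSp _ _ _ Gq); apply: h => x; left.
Qed.

(** Let [n] be least such that [A] does not split [n] times.  By stability
    each [A] together with [range (t l)] still splits [n - 1] times, so that [t]
    makes [A] split [n] times. *)
Lemma stable_no_split kappa r (rel : ('I_kappa -> 'I_r -> Y) -> Prop) (A : set Y) :
  ext A -> (exists n, ~ splits rel n A) ->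
  (forall n l, ext (A `|` [set c | List.In c l]) -> splits rel n A ->
     splits rel n (A `|` [set c | List.In c l])) ->
  forall t : nat -> 'I_r -> Y, (forall i, increasing i -> rel (t \o i)) ->
    ~ forall l, ext (A `|` range (t l)).
Proof.
move=> eA [n nn] stab t trel text.
elim: n nn => [|n IH] nn; first exact: nn.
apply: IH => sp; apply: nn; exists t; split=> // l.
have e : range (t l) = [set c | List.In c [seq t l p | p <- enum 'I_r]].
  apply/seteqP; split=> c.
    by case=> p _ <-; apply/In_map; exists p => //; apply: In_enum.
  by move=> /In_map [p _ <-]; exists p.
by rewrite e; apply: stab => //; rewrite -e.
Qed.

End Splitting.

(** * Pieces of trees as formulas *)

Section Theta.
Variables (L : signature) (k : nat) (X Y : Type).
Variables (phi : form L (X + Y)) (psi : form L ('I_k * Y)).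
Variables (s : seq (seq nat)) (r : nat).

Local Notation node := (seq_sub s).

(** The object variables are all the entries of a finite tree, and the formula
    says that this tree lies over the given [r] parameters.  Since the whole tree
    is the object, a conjunction of two instances speaks of one tree over both
    tuples of parameters ([tree_form_finite]). *)
Definition tree_form : form L ((node * Y + node * X) + ('I_r * Y)) :=
  FAnd (\big[FAnd/FTop]_(p : node * node | prefix (val p.2) (val p.1))
          rename (copair (fun i => inl (inr (p.1, i))) (fun j => inl (inl (p.2, j)))) phi)
 (FAnd (\big[FAnd/FTop]_(p : node * 'I_r)
          rename (copair (fun i => inl (inr (p.1, i))) (fun j => inr (p.2, j))) phi)
       (\big[FAnd/FTop]_(i : {ffun 'I_k -> node} | `[< siblings (fun p => val (i p)) >])
          rename (fun v => inl (inl (i v.1, v.2))) psi)).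

Lemma sat_tree_form (M : structure L) (w : node * Y + node * X -> M) (t : 'I_r * Y -> M) :
  sat (copair w t) tree_form <->
  [/\ forall sigma eta : node, prefix (val eta) (val sigma) ->
        sat (copair (fun i => w (inr (sigma, i))) (fun j => w (inl (eta, j)))) phi,
      forall (sigma : node) p,
        sat (copair (fun i => w (inr (sigma, i))) (fun j => t (p, j))) phi &
      forall i : 'I_k -> node, siblings (fun p => val (i p)) ->
        sat (fun v => w (inl (i v.1, v.2))) psi].
Proof.
split.
  move=> [h1 [h2 h3]]; split.
  - move=> sigma eta es; have := (sat_bigfin _ _ _).1 h1 (sigma, eta) es.
    by rewrite sat_rename copair_comp.
  - move=> sigma p; have := (sat_bigfin _ _ _).1 h2 (sigma, p) isT.
    by rewrite sat_rename copair_comp.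
  - move=> i sib; have e : finfun i =1 i := ffunE i.
    have := (sat_bigfin _ _ _).1 h3 (finfun i); rewrite sat_rename => h.
    have sib' : siblings (fun p => val (finfun i p)).
      suff -> : (fun p => val (finfun i p)) = (fun p => val (i p)) by [].
      by apply/funext => p; rewrite e.
    have := h (asboolT sib'); congr sat; apply/funext => v /=; by rewrite e.
move=> [h1 h2 h3]; split; [|split]; apply/sat_bigfin.
- by move=> [sigma eta] /= es; rewrite sat_rename copair_comp; apply: h1.
- by move=> [sigma p] _; rewrite sat_rename copair_comp; apply: h2.
- by move=> i /asboolP sib; rewrite sat_rename; apply: (h3 i).
Qed.

Lemma finite_tree_form (M : structure L) (B : seq (Y -> M)) (ts : seq ('I_r * Y -> M)) :
  finite_tree phi psi s B ->
  (forall t p, List.In t ts -> List.In (fun j => t (p, j)) B) ->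
  exists w, forall t, List.In t ts -> sat (copair w t) tree_form.
Proof.
move=> [y [x [h1 h2 h3]]] tsB.
exists (fun z => match z with
  | inl (eta, j) => y (val eta) j | inr (sigma, i) => x (val sigma) i end).
move=> t tts; apply/sat_tree_form; split.
- by move=> sigma eta; apply: h1; apply: valP.
- by move=> sigma p; apply: h2; [apply: valP|apply: tsB].
- by move=> i sib; apply: (h3 (fun p => val (i p)) sib) => p; apply: valP.
Qed.

Lemma tree_form_finite (M : structure L) (B : seq (Y -> M)) (ts : seq ('I_r * Y -> M)) w :
  (exists t, List.In t ts) -> (forall t, List.In t ts -> sat (copair w t) tree_form) ->
  (forall b, List.In b B -> exists t p, List.In t ts /\ b = fun j => t (p, j)) ->
  finite_tree phi psi s B.
Proof.
move=> [t0 t0ts] tsat cov; have [h1 _ h3] := (sat_tree_form _ _).1 (tsat t0 t0ts).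
pose at_ (Z : Type) (f : node -> Z -> M) (eta : seq nat) (z : Z) : M :=
  if insub eta is Some e then f e z else structure_point M.
have atE (Z : Type) (f : node -> Z -> M) (e : node) : at_ Z f (val e) = f e.
  by apply/funext => z; rewrite /at_ valK.
have lift eta : eta \in s -> exists e : node, eta = val e by move=> es; exists (SeqSub es).
exists (at_ Y (fun e j => w (inl (e, j)))), (at_ X (fun e i => w (inr (e, i)))); split.
- by move=> sigma eta /lift [e1 ->] /lift [e2 ->] es; rewrite !atE; apply: h1.
- move=> sigma b /lift [e ->] /cov [t [p [tts ->]]]; rewrite atE.
  by have [_ h2 _] := (sat_tree_form _ _).1 (tsat t tts); apply: h2.
- move=> i sib /(fun h p => lift _ (h p)) /choice [e eP].
  have -> : (fun v => at_ Y (fun e j => w (inl (e, j))) (i v.1) v.2) =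
      fun v : 'I_k * Y => w (inl (e v.1, v.2)).
    by apply/funext => v; rewrite eP atE.
  apply: h3; have -> // : (fun p => val (e p)) = i by apply/funext => p; rewrite eP.
Qed.

End Theta.

Section KTP.
Variables (L : signature) (T : theory L) (K : Type) (M : structure L).
Hypothesis hM : monster T K M.

Local Notation F := (form L nat).

Definition flat (kappa r : nat) (Y : Type) (t : 'I_kappa -> 'I_r -> Y -> M)
  (v : 'I_kappa * ('I_r * Y)) : M := t v.1 v.2.1 v.2.2.

(** The conclusion needs a tree that satisfies the formula at its root too, so
    the part above the node [0] of the tree of [splits_tree] is used. *)
Lemma splits_TP (Y X' : finType) (ext : set (Y -> M) -> Prop) kappa r
    (th : form L (X' + 'I_r * Y)) (rho : form L ('I_kappa * ('I_r * Y)))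
    (rel : ('I_kappa -> 'I_r -> Y -> M) -> Prop) :
  0 < kappa -> (forall A B, A `<=` B -> ext B -> ext A) ->
  negation T (ex_andk_fin kappa th) rho ->
  (forall t, rel t -> sat (flat t) rho) ->
  (forall A ts, ext A -> (forall t p, List.In t ts -> A (fun j => t (p, j))) ->
     exists x, forall t, List.In t ts -> sat (copair x t) th) ->
  (forall n, splits ext rel n set0) -> has_TP T M kappa.
Proof.
move=> k0 extS neg relP real sp; apply: (extendable_TP hM neg) => s B B0.
pose n := foldr maxn 0 (map size s).
have sn sigma : sigma \in s -> size sigma <= n.
  rewrite /n; elim: (s) => [//|t s' IH].
  rewrite inE => /orP[/eqP-> /=|/IH h /=]; first exact: leq_maxl.
  exact: leq_trans h (leq_maxr _ _).
have [y [ypath ysib]] := splits_tree (fun=> structure_point M) extS (sp n.+1).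
pose z eta (v : 'I_r * Y) := y (0 :: eta) v.1 v.2.
have /choice [x xP] : forall sigma, exists x, sigma \in s ->
    forall eta, prefix eta sigma -> sat (copair x (z eta)) th.
  move=> sigma; have [ss|ns] := boolP (sigma \in s); last by exists (fun=> structure_point M).
  have [|x xP] := real _ [seq z (take l sigma) | l <- iota 0 (size sigma).+1]
      (ypath (0 :: sigma) (sn _ ss)).
    move=> t p /In_map [l _ <-]; right; exists (0 :: take l sigma), p; split=> //.
    by rewrite prefix_cons eqxx prefix_take.
  exists x => _ eta es; apply: xP; apply/In_map; exists (size eta).
    by apply/In_mem; rewrite mem_iota ltnS size_prefix.
  by move/prefixP: es => [w ->]; rewrite take_size_cat.
exists z, x; split.
- by move=> sigma eta ss _ es; apply: xP.
- by move=> sigma b _ /B0.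
- move=> i [eta [j [inc e]]] si.
  have e0 : size (0 :: eta) < n.+1.
    by have := sn _ (si (Ordinal k0)); rewrite e size_rcons.
  have := relP _ (ysib (0 :: eta) j e0 inc); congr sat.
  by apply/funext => v; rewrite /flat /z e.
Qed.

End KTP.

(** * Lowering k in k-TP *)

Lemma In_cat (Z : Type) (x : Z) (s t : seq Z) :
  List.In x (s ++ t) <-> List.In x s \/ List.In x t.
Proof. by elim: s => [|y s IH] /=; [split; [right|case]|rewrite IH or_assoc]. Qed.

Definition entries (M Y : Type) r (ts : seq ('I_r * Y -> M)) : seq (Y -> M) :=
  flatten [seq [seq (fun j => t (p, j)) | p <- enum 'I_r] | t <- ts].

Lemma In_entries (M Y : Type) r (ts : seq ('I_r * Y -> M)) b :
  List.In b (entries ts) <-> exists t p, List.In t ts /\ b = fun j => t (p, j).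
Proof.
rewrite /entries; elim: ts => [|t ts IH]; first by split=> // -[t [p []]].
rewrite map_cons /= In_cat IH In_map; split.
  case=> [[p _ <-]|[t' [p [tts ->]]]]; first by exists t, p; split=> //; left.
  by exists t', p; split=> //; right.
move=> [t' [p [[->|tts] ->]]]; [left|right].
  by exists p => //; apply: In_enum.
by exists t', p.
Qed.

Section Pairs.
Variables (L : signature) (T : theory L) (k n m : nat).
Variables (phi : form L ('I_n + 'I_m)) (psi : form L ('I_k * 'I_m)).

Lemma half_ltn_uphalf (q : 'I_k) : q./2 < uphalf k.
Proof. have := ltn_ord q; rewrite uphalfE; lia. Qed.

(** The [k] parameters of [psi] fill, in order, the first of uphalf(k) pairs. *)
Definition pair_index (v : 'I_k * 'I_m) : 'I_(uphalf k) * ('I_2 * 'I_m) :=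
  (Ordinal (half_ltn_uphalf v.1), (inord (odd v.1), v.2)).

Definition pair_form : form L ('I_n + ('I_2 * 'I_m)) :=
  FAnd (rename (copair inl (fun j => inr (ord0, j))) phi)
       (rename (copair inl (fun j => inr (ord_max, j))) phi).

Lemma sat_pair_form (M : structure L) (x : 'I_n -> M) (t : 'I_2 * 'I_m -> M) :
  sat (copair x t) pair_form <-> forall p, sat (copair x (fun j => t (p, j))) phi.
Proof.
rewrite /= !sat_rename !copair_comp; split=> [[h0 h1] p|h]; last by split; apply: h.
have [->|p0] := eqVneq p ord0; first exact: h0.
have -> : p = ord_max by apply: val_inj; case: p p0 => -[|[|]].
exact: h1.
Qed.

Lemma negation_pair_form :
  negation T (ex_andk k phi) psi ->
  negation T (ex_andk_fin (uphalf k) pair_form) (rename pair_index psi).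
Proof.
move=> neg N NT [t [/sat_ex_andk_fin [x h1] /sat_rename h2]]; apply: (neg N NT).
exists (t \o pair_index); split=> //; apply/sat_ex_andk; exists x => q.
pose tq v := t (Ordinal (half_ltn_uphalf q), v).
exact: (sat_pair_form x tq).1 (h1 _) (inord (odd q)).
Qed.

Lemma sat_flat_pairs (M : structure L) (t : nat -> 'I_2 -> 'I_m -> M)
    (u : nat -> 'I_m -> M) (i : 'I_(uphalf k) -> nat) :
  (forall l p, t l p = u (l.*2 + p)) -> increasing i ->
  (forall i' : 'I_k -> nat, increasing i' -> sat (fun v => u (i' v.1) v.2) psi) ->
  sat (flat (t \o i)) (rename pair_index psi).
Proof.
move=> tu inc h; apply/sat_rename.
pose i' (q : 'I_k) := (i (Ordinal (half_ltn_uphalf q))).*2 + odd q.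
have -> : flat (t \o i) \o pair_index = fun v => u (i' v.1) v.2.
  by apply/funext => v; rewrite /flat /= tu /i' inordK //; case: odd.
apply: h => p q pq; rewrite /i'.
set a := Ordinal _; set b := Ordinal _.
have [ab|ab] : a < b \/ a = b /\ odd p < odd q.
    have : p./2 < q./2 \/ p./2 = q./2 /\ odd p < odd q by lia.
    by case=> [|[e o]]; [left|right; split=> //; apply: val_inj].
  have := inc _ _ ab; case: odd; case: odd; lia.
by case: ab => -> o; lia.
Qed.

End Pairs.

Section Reduce.
Variables (L : signature) (T : theory L) (K : Type) (M : structure L).
Hypothesis hM : monster T K M.

Local Notation F := (form L nat).

Lemma extendable_fin k (X Y : Type) (phi : form L (X + Y)) (psi : form L ('I_k * Y))
    (A : set (Y -> M)) :
  (forall s, (forall c, List.In c s -> A c) ->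
     extendable phi psi [set c | List.In c s]) -> extendable phi psi A.
Proof. by move=> h s B BA; apply: (h B BA). Qed.

(** A set [A] that is stable for all patterns is widened and the pairs of its
    one-point extensions are coloured; a homogeneous sequence makes [A] split,
    against stability. *)
Lemma TP_reduce k : 3 <= k -> has_TP T M k ->
  exists k', [/\ 2 <= k', k' < k & has_TP T M k'].
Proof.
move=> k3 [n [m [phi [a0 [psi [neg path sib]]]]]].
have ext0 := tree_extendable path sib.
apply: contrapT => none.
have Fnat := embeds_nat_form L.
pose Y : Type := 'I_m -> M.
pose ext : set Y -> Prop := extendable phi psi.
have extS A B : A `<=` B -> ext B -> ext A by apply: extendable_sub.
pose c0 : Y := fun=> structure_point M.
(* One pattern consists of pairs that are uphalf(k)-inconsistent for [phi];
   the others, for a finite set [s] of nodes and a code [chi] of a negation,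
   of [r]-tuples that are 2-inconsistent for [tree_form]. *)
pose rel2 (t : 'I_(uphalf k) -> 'I_2 -> Y) := sat (flat t) (rename (@pair_index k m) psi).
pose rel (s : seq (seq nat)) (r : nat) (chi : F) (t : 'I_2 -> 'I_r -> Y) :=
  exists rho, [/\ negation T (ex_andk_fin 2 (tree_form phi psi s r)) rho,
    rename pickle rho = chi & sat (flat t) rho].
pose Sp (e : option (seq (seq nat) * nat * F)) (d : nat) (A : set Y) : Prop :=
  match e with
  | None => splits ext rel2 d A
  | Some (s, r, chi) => splits ext (rel s r chi) d A
  end.
have SpS e d A B : A `<=` B -> Sp e d B -> Sp e d A.
  by case: e => [[[s r] chi]|]; apply: splits_sub.
have bE : bounded F (option (seq (seq nat) * nat * F)).
  apply: (@bounded_embeds _ _ (unit + (seq (seq nat) * nat * F))).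
    by exists (fun o => if o is Some x then inr x else inl tt) => -[x|] [y|] // [->].
  apply: bounded_sum; first exact: bounded_count.
  apply: bounded_prod; last exact: bounded_base.
  exact: bounded_count.
(* A pattern that can be iterated arbitrarily often gives k'-TP for some
   [k' < k]. *)
have Spfin e : exists d, ~ Sp e d set0.
  apply: contrapT => all; have {}all d : Sp e d set0.
    by apply: contrapT => h; apply: all; exists d.
  apply: none; case: e all => [[[s r] chi]|] all.
    have [t [trel _]] := all 1.
    have [rho [neg_rho e_rho _]] := trel (@nat_of_ord 2) (fun p q pq => pq).
    exists 2; split=> //; apply: (splits_TP hM (ext := ext) _ extS neg_rho _ _ all) => //.
      move=> t' [rho' [_ e' h']]; apply: sat_coded h'; by rewrite e_rho.
    move=> A ts eA tsA.
    apply: (@finite_tree_form _ _ _ _ phi psi s r M (entries ts)).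
      by apply: eA => b /In_entries [t' [p [tts ->]]]; apply: tsA.
    by move=> t' p tts; apply/In_entries; exists t', p.
  exists (uphalf k); split; [rewrite uphalfE; lia|rewrite uphalfE; lia|].
  apply: (splits_TP hM (ext := ext) _ extS (negation_pair_form neg) _ _ all) => //.
    by rewrite uphalfE; lia.
  move=> A ts eA tsA; have [|y [x [_ h _]]] := eA [:: [::]] (entries ts).
    by move=> b /In_entries [t' [p [tts ->]]]; apply: tsA.
  exists (x [::]) => t tts; apply/sat_pair_form => p; apply: h => //.
  by apply/In_entries; exists t, p.
have [A [[D [g [bD Ag]]] eA stab]] := stable_set c0 extS Fnat bE SpS
  (@extendable_fin _ _ _ phi psi) ext0.
have nosplit e : exists d, ~ Sp e d A.
  by have [d nd] := Spfin e; exists d; apply: contra_not nd; apply: SpS.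
have [W [lt [bW wo ER]]] := erdos_rado_type Fnat
  (bounded_prod (bounded_seq Fnat bD) bE).
have [b [bsib bext]] := widen hM bD Ag bW wo eA.
(* The elements of [A] listed by [ds] followed by [c], which is the default
   value of [nth]. *)
pose tup r (ds : seq D) (c : Y) (p : 'I_r) : Y := nth c (map g ds) p.
have tup_in r ds c : (forall d, List.In d ds -> A (g d)) ->
    range (@tup r ds c) `<=` A `|` [set c].
  move=> dsA _ [p _ <-]; rewrite /tup; have [h|h] := ltnP p (size ds); last first.
    by right; rewrite /= nth_default // size_map.
  left; elim: ds (nat_of_ord p) h dsA => [//|d ds IH] [|q] h dsA /=.
    by apply: dsA; left.
  by apply: IH => // d' h'; apply: dsA; right.
(* The colour of a pair is the reason why its members cannot both be added to
   [A], or [None] if they can. *)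
have /choice [f fP] : forall ww : W * W,
    exists c : seq D * option (seq (seq nat) * nat * F),
    match c.2 with
    | None => ext (A `|` [set b ww.1; b ww.2])
    | Some (s, r, chi) => (forall d, List.In d c.1 -> A (g d)) /\
        rel s r chi (fun i => @tup r c.1 (b (if i == ord0 then ww.1 else ww.2)))
    end.
  move=> [w w'] /=; have [good|bad] := EM (ext (A `|` [set b w; b w'])).
    by exists ([::], None).
  have [s [B [BA nB]]] : exists s B, (forall c, List.In c B -> (A `|` [set b w; b w']) c) /\
      ~ finite_tree phi psi s B.
    apply: contrapT => no; apply: bad => s B BA; apply: contrapT => h.
    by apply: no; exists s, B.
  have [ds [dsA cov]] : exists ds, (forall d, List.In d ds -> A (g d)) /\
      forall c, List.In c B -> List.In c (map g ds) \/ c = b w \/ c = b w'.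
    elim: B BA {nB} => [|c B IH] BA; first by exists [::].
    have [|ds [dsA cov]] := IH; first by move=> d hd; apply: BA; right.
    have [Ac|cw] : A c \/ c = b w \/ c = b w'.
      by case: (BA c (or_introl erefl)) => [|[|]]; auto.
      have [d _ e] := Ag c Ac; exists (d :: ds).
      split=> [d' [<-|/dsA //]|c' [<-|/cov h]]; first by rewrite e.
        by left; left.
      by case: h; [left; right|right].
    by exists ds; split=> // c' [<-|/cov //]; right.
  pose r := (size ds).+1; pose t (i : 'I_2) := @tup r ds (b (if i == ord0 then w else w')).
  have [|rho [neg_rho srho]] := @ec_negation L T K M hM _
      (ex_andk_fin 2 (tree_form phi psi s r)) (flat t).
    move=> /sat_ex_andk_fin [x xP]; apply: nB.
    pose t1 i (v : 'I_r * 'I_m) := flat t (i, v).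
    apply: (@tree_form_finite _ _ _ _ phi psi s r M B [:: t1 ord0; t1 ord_max] x).
    - by exists (t1 ord0); left.
    - by move=> _ [<-|[<-|//]]; apply: xP.
    - have last_b c : nth c (map g ds) (@ord_max (size ds)) = c.
        by rewrite nth_default // size_map.
      move=> c /cov [|[->|->]].
      + move=> h; have [p ps e] : exists2 p, p < size ds & forall c', nth c' (map g ds) p = c.
          elim: (ds) h => [//|d ds' IH] /= [<-|/IH [p ps e]]; first by exists 0.
          by exists p.+1.
        have pr : p < r by rewrite ltnS ltnW.
        by exists (t1 ord0), (Ordinal pr); split; [left|rewrite /t1 /flat /t /tup /= e].
      + exists (t1 ord0), ord_max; split; [by left|].
        by rewrite /t1 /flat /t /tup /= -{1}(last_b (b w)).
      + exists (t1 ord_max), ord_max; split; [by right; left|].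
        by rewrite /t1 /flat /t /tup /= -{1}(last_b (b w')).
  by exists (ds, Some (s, r, rename pickle rho)); split=> //; exists rho.
have [[ds e] [u uP]] := ER (fun w w' => f (w, w')).
have bu_ext l : ext (A `|` [set b (u l)]) by exact: bext.
case: e uP => [[[s r] chi]|] uP.
  have fuP i j : i < j -> (forall d, List.In d ds -> A (g d)) /\
      rel s r chi (fun q : 'I_2 => @tup r ds (b (if q == ord0 then u i else u j))).
    by move=> ij; have [_ e] := uP i j ij; have := fP (u i, u j); rewrite e.
  have [dsA _] := fuP 0 1 isT.
  apply: (stable_no_split eA (nosplit (Some (s, r, chi)))
    (fun d l => @stab (Some (s, r, chi)) d l) (t := fun l => @tup r ds (b (u l)))).
    move=> i inc; have [_] := fuP (i ord0) (i ord_max) (inc ord0 ord_max isT).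
    congr (rel s r chi); apply/funext => q /=.
    have [->//|q0] := eqVneq q ord0.
    by have -> : q = ord_max by apply: val_inj; case: q q0 => -[|[|]].
  move=> l; apply: extS (bu_ext l) => c [Ac|/(tup_in _ _ _ dsA) //]; by left.
have fuP i j : i < j -> ext (A `|` [set b (u i); b (u j)]).
  by move=> ij; have [_ e] := uP i j ij; have := fP (u i, u j); rewrite e.
pose t l (p : 'I_2) := b (u (l.*2 + p)).
apply: (stable_no_split eA (nosplit None) (fun d l => @stab None d l) (t := t)).
  move=> i inc; apply: (@sat_flat_pairs L k m psi M t (b \o u) i) => // i' inc'.
  apply: (bsib (u \o i')) => p q pq; exact: (uP _ _ (inc' _ _ pq)).1.
move=> l; apply: extS (fuP l.*2 l.*2.+1 (ltnSn _)) => c [Ac|[p _ <-]]; first by left.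
right; rewrite /t; case: p => -[|[|//]] hp /=; first by left; rewrite addn0.
by right; rewrite addn1.
Qed.

End Reduce.

(** * The implications *)

Lemma TP_TP2 (L : signature) (T : theory L) (K : Type) (M : structure L)
    (hM : monster T K M) (k : nat) : 2 <= k -> has_TP T M k -> has_TP T M 2.
Proof.
elim/ltn_ind: k => k IH k2 tp.
have [->//|k3] : 2 = k \/ 3 <= k by lia.
by have [k' [k'2 k'k tp']] := TP_reduce hM k3 tp; apply: IH k'k k'2 tp'.
Qed.

Theorem theorem1p1 (L : signature) (T : theory L)
    (hJCP : joint_continuation T)
    (K : Type) (M : structure L) (hM : monster T K M)
    (k : nat) (hk : 2 <= k) :
  (has_SOP3 T M -> has_SOP2 T M) /\
  (has_SOP2 T M <-> has_TP1 T M) /\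
  (has_SOP2 T M -> has_SOP1 T M) /\
  (has_SOP1 T M -> has_TP T M 2) /\
  (has_TP T M 2 <-> has_TP T M k) /\
  (has_TP T M 2 -> has_OP T M) /\
  (has_TP2 T M 2 -> has_TP2 T M k) /\
  (has_TP2 T M k -> has_TP T M k) /\
  (has_TP2 T M 2 -> has_IP T M) /\
  (has_IP T M -> has_OP T M).
Proof.
split; first exact: (SOP3_SOP2 hM).
split; first by split; [exact: SOP2_TP1|exact: TP1_SOP2].
split; first exact: SOP2_SOP1.
split; first exact: SOP1_TP.
split; first by split; [exact: TP_two|exact: (TP_TP2 hM hk)].
split; first exact: (TP_OP hM).
split; first exact: TP2_two.
split; first exact: TP2_TP.
split; first exact: TP2_IP.
exact: IP_OP.
Qed.
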